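(* Let $H$ be a Hilbert space and let $\mathcal T=(T(t))_{t\ge 0}$ be a $C_0$-semigroup on $H$. The following are equivalent. (i) There exists $\tau>0$ such that $T(\tau)$ is similar to a contraction. (ii) For each $\tau>0$, the family $(T(t))_{t\ge\tau}$ is jointly similar to contractions. (iii) For each $\tau>0$, there exist a Hilbert space $K$, operators $B\in\mathcal L(H,K)$, $A\in\mathcal L(K,H)$ and a unitary $C_0$-group $\mathcal U=(U(t))_{t\in\mathbb R}$ on $K$ such that $T(t)=AU(t)B$ for all $t\ge\tau$. (iv) There exist $\tau>0$, a Hilbert space $K$, operators $B\in\mathcal L(H,K)$, $A\in\mathcal L(K,H)$ and a $C_0$-semigroup $\mathcal S=(S(t))_{t\ge0}$ on $K$ which is similar to a semigroup of contractions, such that $T(t)=AS(t)B$ for all $t\ge\tau$.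
   Context: $\mathcal L(H,K)$ denotes bounded linear operators from $H$ to $K$. An operator $T\in\mathcal L(H)$ is similar to a contraction if there is an invertible $R\in\mathcal L(H)$ with $\|RTR^{-1}\|\le 1$. A family $(T_\gamma)_{\gamma\in\Gamma}\subset\mathcal L(H)$ is jointly similar to contractions if there is a single invertible $R\in\mathcal L(H)$ with $\|RT_\gamma R^{-1}\|\le1$ for all $\gamma\in\Gamma$. A $C_0$-semigroup $\mathcal S$ on $K$ is similar to a semigroup of contractions if the family $(S(t))_{t\ge0}$ is jointly similar to contractions. *)

(* Defs.v *)
From HB Require Import structures.
From mathcomp Require Import all_boot all_order all_algebra.
From mathcomp Require Import reals.
From mathcomp.real_closed Require Import complex.
Set Implicit Arguments. Unset Strict Implicit. Unset Printing Implicit Defensive.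
Import Order.TTheory GRing.Theory Num.Theory.
Local Open Scope ring_scope.

Section Hilbert.
Variable R : realType.
Local Notation C := (R[i]).

Definition hnorm (V : lmodType C) (ip : V -> V -> C) (x : V) : R :=
  Num.sqrt (complex.Re (ip x x)).

Record is_hilbert (V : lmodType C) (ip : V -> V -> C) : Prop := {
  ip_linl : forall (a : C) (x y z : V), ip (a *: x + y) z = a * ip x z + ip y z;
  ip_conj : forall x y : V, ip y x = conjc (ip x y);
  ip_pos  : forall x : V, 0 <= complex.Re (ip x x) /\ complex.Im (ip x x) = 0;
  ip_def  : forall x : V, ip x x = 0 -> x = 0;
  ip_complete : forall u : nat -> V,
    (forall e : R, 0 < e -> exists N, forall m n, (N <= m)%N -> (N <= n)%N ->
        hnorm ip (u m - u n) < e) ->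
    exists l : V, forall e : R, 0 < e -> exists N, forall n, (N <= n)%N ->
        hnorm ip (u n - l) < e }.

Definition bounded_op (V W : lmodType C) (ipV : V -> V -> C) (ipW : W -> W -> C)
  (f : V -> W) : Prop :=
  (forall (a : C) (x y : V), f (a *: x + y) = a *: f x + f y) /\
  exists M : R, forall x, hnorm ipW (f x) <= M * hnorm ipV x.

Definition invertible_op (V : lmodType C) (ip : V -> V -> C) (f : V -> V) : Prop :=
  bounded_op ip ip f /\ exists g : V -> V,
    bounded_op ip ip g /\ cancel f g /\ cancel g f.

Definition jointly_similar_to_contractions (V : lmodType C) (ip : V -> V -> C)
  (I : Type) (F : I -> V -> V) : Prop :=
  exists Q g : V -> V, bounded_op ip ip Q /\ bounded_op ip ip g /\
    cancel Q g /\ cancel g Q /\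
    forall (i : I) (x : V), hnorm ip (Q (F i (g x))) <= hnorm ip x.

Definition similar_to_contraction (V : lmodType C) (ip : V -> V -> C)
  (A : V -> V) : Prop :=
  jointly_similar_to_contractions ip (fun _ : unit => A).

(* C_0-semigroup (only the values at t >= 0 matter) *)
Record c0_semigroup (V : lmodType C) (ip : V -> V -> C) (T : R -> V -> V) : Prop := {
  sg_bounded : forall t, 0 <= t -> bounded_op ip ip (T t);
  sg_zero : forall x, T 0 x = x;
  sg_add : forall t s, 0 <= t -> 0 <= s -> forall x, T (t + s) x = T t (T s x);
  sg_cont : forall x (e : R), 0 < e -> exists d : R, 0 < d /\
      forall t, 0 <= t -> t < d -> hnorm ip (T t x - x) < e }.

Definition semigroup_similar_to_contractions (V : lmodType C) (ip : V -> V -> C)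
  (S : R -> V -> V) : Prop :=
  jointly_similar_to_contractions ip (fun t : {t : R | 0 <= t} => S (sval t)).

Record unitary_c0_group (V : lmodType C) (ip : V -> V -> C) (U : R -> V -> V) : Prop := {
  ug_bounded : forall t, bounded_op ip ip (U t);
  ug_zero : forall x, U 0 x = x;
  ug_add : forall t s x, U (t + s) x = U t (U s x);
  ug_cont : forall x (e : R), 0 < e -> exists d : R, 0 < d /\
      forall t, `|t| < d -> hnorm ip (U t x - x) < e;
  ug_unitary : forall t x y, ip (U t x) (U t y) = ip x y }.

End Hilbert.

(* Main.v *)
(** The main point is that (i) implies (iii). Renorm [H] so that [T(sigma)] is a contraction
    and let [f] be the average of [<T(s)x, T(s)y>] over the period [0, sigma]. Translating by
    [t] only exchanges a boundary layer for its image under [T(sigma)], so every [T(t)] is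
    contractive for [f]; and [f] dominates [|T(b)x|^2] for small [b > 0]. No integral is needed:
    [f] is an ultrafilter limit of Riemann sums. A contraction semigroup for a (degenerate) form
    has a unitary dilation, namely the Hilbert space of the positive definite kernel
    [f(T(t-s)x, y)], on which time translation is a unitary group [U]. There [T(b)] factors
    through [B : x |-> (0, x)] by Douglas' lemma, [T(b) = A0 B], whence
    [T(t) = A0 U(-b) U(t) B] for [t >= b].

    Conversely, if [T(t) = A S(t) B] on a subsemigroup with [S] contractive, the quotient norm
    [inf {|e| : A e = h}] over a suitable [S]-invariant subspace makes the [T(t)] contractive. It
    is a Hilbert norm equivalent to the given one, and the square root of the positive operator
    relating the two is the required similarity. *)

Require Import Defs.
From HB Require Import structures.
From mathcomp Require Import all_boot all_order all_algebra.
From mathcomp Require Import ring lra.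
From mathcomp Require Import boolp classical_sets filter reals.
From mathcomp.real_closed Require Import complex.
Set Implicit Arguments. Unset Strict Implicit. Unset Printing Implicit Defensive.
Import Order.TTheory GRing.Theory Num.Theory.
Local Open Scope ring_scope.
Local Notation normc := ComplexField.Normc.normc.

(** * Identities in abelian groups *)

(** The averaged form [f] need not be equivalent to the norm of [H]: it bounds [|T(b) x|^2] only
    with a constant containing the factor [sigma / b], since only times below [b] can be propagated
    forward to [b]. Hence the factorization starts at a positive time. Riemann sums obey the
    translation inequality exactly for [t] on the mesh. Other [t] are rounded up, and the error is
    sent to zero by strong continuity and by a bound on [T] over compact intervals, which comes from
    the uniform boundedness principle. Convergence of the sums is not established, so a generalized
    limit stands in for the limit. As [f] may be degenerate, norms are developed for semi-inner
    products, and the spaces built from them consist of functions, so that null vectors vanish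
    without a quotient. In the converse direction the contractive norm is realised by an embedding
    [E] of [H] in another space, whereas similarity asks for an operator on [H]. A square root of a
    multiple of the adjoint of [E] times [E], built by iteration, brings it back to [H]. *)

Inductive zexpr := ZVar of nat | ZZero | ZAdd of zexpr & zexpr | ZOpp of zexpr.

Fixpoint zeval (V : zmodType) (env : seq V) (e : zexpr) : V :=
  match e with
  | ZVar i => env`_i
  | ZZero => 0
  | ZAdd a b => zeval env a + zeval env b
  | ZOpp a => - zeval env a
  end.

Fixpoint zcoef (i : nat) (e : zexpr) : int :=
  match e with
  | ZVar j => (i == j)%:R
  | ZZero => 0
  | ZAdd a b => zcoef i a + zcoef i b
  | ZOpp a => - zcoef i a
  end.

Lemma zeval_coef (V : zmodType) (env : seq V) e :
  zeval env e = \sum_(i < size env) env`_i *~ zcoef i e.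
Proof.
elim: e => [j||a IHa b IHb|a IHa] /=.
- have [jl|jg] := ltnP j (size env).
    rewrite (bigD1 (Ordinal jl)) //= eqxx big1 ?addr0 // => i /negPf.
    by rewrite -val_eqE /= => ->; rewrite mulr0z.
  rewrite nth_default // big1 // => i _; case: eqP => [ij|_]; last by rewrite mulr0z.
  by move: (ltn_ord i); rewrite ij ltnNge jg.
- by rewrite big1 // => i _; rewrite mulr0z.
- by rewrite IHa IHb -big_split /=; apply: eq_bigr => i _; rewrite mulrzDr.
- by rewrite IHa -sumrN; apply: eq_bigr => i _; rewrite mulrNz.
Qed.

(** An identity valid in every abelian group amounts to equal integer coefficients at each atom, and
    these are compared by computation. This is the engine of [zmod]. *)
Lemma zeval_eq (V : zmodType) (env : seq V) e1 e2 :
  all (fun i => zcoef i e1 == zcoef i e2) (iota 0 (size env)) ->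
  zeval env e1 = zeval env e2.
Proof.
move=> /allP h; rewrite !zeval_coef; apply: eq_bigr => i _.
by rewrite (eqP (h i _)) // mem_iota /=.
Qed.

(* Atoms are compared up to conversion: equal scaled vectors often carry syntactically
   different structure instances. *)
Ltac zmod_same x y :=
  match constr:(Set) with
  | _ => let _ := match constr:(Set) with _ => unify x y end in constr:(true)
  | _ => constr:(false)
  end.

Ltac zmod_mem x l :=
  match l with
  | nil => constr:(false)
  | cons ?y ?l' => let b := zmod_same x y in
      match b with true => constr:(true) | false => zmod_mem x l' end
  end.

Ltac zmod_atoms V t l :=
  match t with
  | @GRing.add _ ?a ?b => let l1 := zmod_atoms V a l in zmod_atoms V b l1
  | @GRing.opp _ ?a => zmod_atoms V a l
  | @GRing.zero _ => l
  | ?x => let m := zmod_mem x l in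
          match m with true => l | false => constr:(@cons V x l) end
  end.

Ltac zmod_index x l :=
  match l with
  | cons ?y ?l' => let b := zmod_same x y in
      match b with
      | true => constr:(O)
      | false => let n := zmod_index x l' in constr:(S n)
      end
  end.

Ltac zmod_reify t l :=
  match t with
  | @GRing.add _ ?a ?b =>
      let ra := zmod_reify a l in let rb := zmod_reify b l in constr:(ZAdd ra rb)
  | @GRing.opp _ ?a => let ra := zmod_reify a l in constr:(ZOpp ra)
  | @GRing.zero _ => constr:(ZZero)
  | ?x => let n := zmod_index x l in constr:(ZVar n)
  end.

Ltac zmod :=
  match goal with |- @eq ?V ?s ?t =>
    let l := zmod_atoms V s (@nil V) in let l := zmod_atoms V t l in
    let rs := zmod_reify s l in let rt := zmod_reify t l in
    apply: (@zeval_eq _ l rs rt); vm_compute; reflexivity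
  end.

(** * Semi-inner products *)

Lemma normc_ge0 (R : rcfType) (a : R[i]) : 0 <= normc a.
Proof. by case: a => ? ?; exact: sqrtr_ge0. Qed.

Section SemiInner.
Variables (R : realType) (V : lmodType R[i]) (ip : V -> V -> R[i]).

(** Definiteness and completeness are left out so that the averaged form, its Riemann sums, the Gram
    form of a kernel and [<S x, y>] for positive [S] share one theory. *)
Record semi_inner : Prop := {
  si_lin : forall (a : R[i]) (x y z : V), ip (a *: x + y) z = a * ip x z + ip y z;
  si_conj : forall x y : V, ip y x = conjc (ip x y);
  si_pos : forall x : V, 0 <= complex.Re (ip x x) }.

Hypothesis hip : semi_inner.
Local Notation N := (hnorm ip).

Definition rip (x y : V) : R := complex.Re (ip x y).

Lemma ipDl x y z : ip (x + y) z = ip x z + ip y z.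
Proof. by rewrite -[x in LHS]scale1r (si_lin hip) mul1r. Qed.

Lemma ip0l z : ip 0 z = 0.
Proof. by apply: (addrI (ip 0 z)); rewrite -ipDl !addr0. Qed.

Lemma ipZl a x z : ip (a *: x) z = a * ip x z.
Proof. by rewrite -[a *: x]addr0 (si_lin hip) ip0l addr0. Qed.

Lemma ipNl x z : ip (- x) z = - ip x z.
Proof. by rewrite -scaleN1r ipZl mulN1r. Qed.

Lemma ipBl x y z : ip (x - y) z = ip x z - ip y z.
Proof. by rewrite ipDl ipNl. Qed.

Lemma ipDr x y z : ip z (x + y) = ip z x + ip z y.
Proof. by rewrite (si_conj hip) ipDl rmorphD /= -!(si_conj hip). Qed.

Lemma ip0r z : ip z 0 = 0.
Proof. by rewrite (si_conj hip) ip0l conjc0. Qed.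

Lemma ipZr a x z : ip z (a *: x) = conjc a * ip z x.
Proof. by rewrite (si_conj hip) ipZl rmorphM /= -(si_conj hip). Qed.

Lemma ipNr x z : ip z (- x) = - ip z x.
Proof. by rewrite (si_conj hip) ipNl rmorphN /= -(si_conj hip). Qed.

Lemma ipBr x y z : ip z (x - y) = ip z x - ip z y.
Proof. by rewrite ipDr ipNr. Qed.

Lemma ip_Im x : complex.Im (ip x x) = 0.
Proof. by have := si_conj hip x x; case: (ip x x) => a b [] /=; lra. Qed.

(** [ip] is conjugate-linear in the second slot, so multiplying [y] by [i] turns imaginary parts
    into real ones, and estimates for [rip] carry over. *)
Lemma Im_rip x y : complex.Im (ip x y) = rip x ('i%C *: y).
Proof. rewrite /rip ipZr; case: (ip x y) => a b /=; ring. Qed.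

Lemma ripC x y : rip x y = rip y x.
Proof. by rewrite /rip (si_conj hip); case: (ip y x). Qed.

Lemma ripDl x y z : rip (x + y) z = rip x z + rip y z.
Proof. by rewrite /rip ipDl raddfD. Qed.

Lemma ripNl x z : rip (- x) z = - rip x z.
Proof. by rewrite /rip ipNl raddfN. Qed.

Lemma ripBl x y z : rip (x - y) z = rip x z - rip y z.
Proof. by rewrite ripDl ripNl. Qed.

Lemma ripDr x y z : rip z (x + y) = rip z x + rip z y.
Proof. by rewrite ripC ripDl !(ripC z). Qed.

Lemma ripNr x z : rip z (- x) = - rip z x.
Proof. by rewrite ripC ripNl !(ripC z). Qed.

Lemma ripBr x y z : rip z (x - y) = rip z x - rip z y.
Proof. by rewrite ripDr ripNr. Qed.

Lemma ripZl (r : R) x z : rip (r%:C%C *: x) z = r * rip x z.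
Proof. by rewrite /rip ipZl; case: (ip x z) => a b /=; ring. Qed.

Lemma ripZr (r : R) x z : rip z (r%:C%C *: x) = r * rip z x.
Proof. by rewrite ripC ripZl ripC. Qed.

Lemma hnorm_ge0 x : 0 <= N x.
Proof. exact: sqrtr_ge0. Qed.

Lemma hnorm_sq x : N x ^+ 2 = rip x x.
Proof. by rewrite /hnorm sqr_sqrtr //; exact: si_pos. Qed.

Lemma hnorm0 : N 0 = 0.
Proof. by rewrite /hnorm ip0l /= sqrtr0. Qed.

Lemma hnormZ a x : N (a *: x) = normc a * N x.
Proof.
rewrite /hnorm ipZl ipZr; have := si_pos hip x; have := ip_Im x.
case: (ip x x) => s t /= -> s0; case: a => a b /=.
rewrite -sqrtrM ?addr_ge0 ?sqr_ge0 //; congr Num.sqrt; ring.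
Qed.

Lemma hnormZr (r : R) x : N (r%:C%C *: x) = `|r| * N x.
Proof. by rewrite hnormZ /= expr0n addr0 sqrtr_sqr. Qed.

Lemma hnorm_opp x : N (- x) = N x.
Proof. by rewrite /hnorm ipNl ipNr opprK. Qed.

Lemma hnormBC x y : N (x - y) = N (y - x).
Proof. by rewrite -hnorm_opp opprB. Qed.

Lemma hnormD_sq x y : N (x + y) ^+ 2 = N x ^+ 2 + N y ^+ 2 + 2 * rip x y.
Proof. rewrite !hnorm_sq !ripDl !ripDr (ripC y x); ring. Qed.

Lemma hnormB_sq x y : N (x - y) ^+ 2 = N x ^+ 2 + N y ^+ 2 - 2 * rip x y.
Proof. rewrite hnormD_sq hnorm_opp ripNr; ring. Qed.

Lemma rip_le x y : rip x y <= N x * N y.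
Proof.
have [p0|p0] := leP (rip x y) 0; first by rewrite (le_trans p0) // mulr_ge0 ?hnorm_ge0.
rewrite -(ler_pXn2r (n := 2)) ?nnegrE ?mulr_ge0 ?hnorm_ge0 ?(ltW p0) //.
rewrite exprMn.
have [y0|y0] := eqVneq (N y ^+ 2) 0.
  (* A null vector [y] with [rip x y > 0] is impossible: for this scalar the square expands to
     [N x ^+ 2 - (N x ^+ 2 + 1) = -1]. *)
  have := sqr_ge0 (N (x - ((N x ^+ 2 + 1) / (2 * rip x y))%:C%C *: y)).
  rewrite hnormB_sq hnormZr exprMn y0 mulr0 ripZr.
  have -> : 2 * ((N x ^+ 2 + 1) / (2 * rip x y) * rip x y) = N x ^+ 2 + 1.
    by field; rewrite gt_eqF.
  by lra.
have yp : 0 < N y ^+ 2 by rewrite lt_def y0 sqr_ge0.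
have := sqr_ge0 (N (x - (rip x y / N y ^+ 2)%:C%C *: y)).
rewrite hnormB_sq hnormZr exprMn real_normK ?num_real // ripZr.
set p := rip x y; set n := N y ^+ 2 in yp *.
have -> : N x ^+ 2 + (p / n) ^+ 2 * n - 2 * (p / n * p) = N x ^+ 2 - p ^+ 2 / n.
  by field; rewrite gt_eqF.
by rewrite subr_ge0 ler_pdivrMr.
Qed.

Lemma rip_abs x y : `|rip x y| <= N x * N y.
Proof. by rewrite ler_norml rip_le andbT lerNl -ripNl -(hnorm_opp x) rip_le. Qed.

Lemma hnorm_i x : N ('i%C *: x) = N x.
Proof. by rewrite hnormZ /= expr0n expr1n add0r sqrtr1 mul1r. Qed.

Lemma Im_ip_abs x y : `|complex.Im (ip x y)| <= N x * N y.
Proof. by rewrite Im_rip (le_trans (rip_abs _ _)) // hnorm_i. Qed.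

Lemma ler_hnormD x y : N (x + y) <= N x + N y.
Proof.
rewrite -(ler_pXn2r (n := 2)) ?nnegrE ?addr_ge0 ?hnorm_ge0 //.
by rewrite hnormD_sq; have := rip_le x y; lra.
Qed.

Lemma ler_hnormB x y : N (x - y) <= N x + N y.
Proof. by rewrite (le_trans (ler_hnormD _ _)) // hnorm_opp. Qed.

Lemma ler_hnorm_split z x y : N (x - y) <= N (x - z) + N (z - y).
Proof. by rewrite -(subrKA z) ler_hnormD. Qed.

Lemma ler_hnorm_dist x y : `|N x - N y| <= N (x - y).
Proof.
rewrite ler_norml; apply/andP; split.
  have := ler_hnormD (y - x) x; rewrite subrK hnormBC; lra.
by have := ler_hnormD (x - y) y; rewrite subrK; lra.
Qed.

(** Difference of squares combined with [N y - N x <= N (x - y)]; it carries bounds on squared norms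
    across small perturbations. *)
Lemma ler_hnorm_sqB x y : N y ^+ 2 <= N x ^+ 2 + N (x - y) * (N x + N y).
Proof.
have := ler_hnorm_dist x y; rewrite ler_norml => /andP[h1 _].
have := hnorm_ge0 x; have := hnorm_ge0 y; nra.
Qed.

Lemma hnorm_parallelogram x y :
  N (x + y) ^+ 2 + N (x - y) ^+ 2 = 2 * N x ^+ 2 + 2 * N y ^+ 2.
Proof. rewrite hnormD_sq hnormB_sq; ring. Qed.

Lemma hnorm_eq0_ip x y : N x = 0 -> ip x y = 0.
Proof.
move=> x0; apply/eqP; rewrite eq_complex /=.
have := rip_abs x y; have := Im_ip_abs x y.
by rewrite x0 !mul0r !normr_le0 => -> ->.
Qed.

End SemiInner.

Section Hilbert.
Variables (R : realType) (V : lmodType R[i]) (ip : V -> V -> R[i]).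
Hypothesis hip : is_hilbert ip.
Local Notation N := (hnorm ip).

Lemma hilbert_semi : semi_inner ip.
Proof.
split; [exact: ip_linl hip|exact: ip_conj hip|].
by move=> x; case: (ip_pos hip x).
Qed.

Lemma hnorm_eq0 x : N x = 0 -> x = 0.
Proof.
by move=> x0; apply: (ip_def hip); apply: hnorm_eq0_ip => //; exact: hilbert_semi.
Qed.

Lemma hnorm_small0 x : (forall e, 0 < e -> N x <= e) -> x = 0.
Proof.
move=> h; apply: hnorm_eq0; apply/eqP.
rewrite eq_le (hnorm_ge0 ip) andbT; apply/ler_addgt0Pl => e e0.
by rewrite addr0 h.
Qed.

Lemma hnorm_small_eq x y : (forall e, 0 < e -> N (x - y) <= e) -> x = y.
Proof. by move=> /hnorm_small0/eqP; rewrite subr_eq0 => /eqP. Qed.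

End Hilbert.

(** * Convergence, projections and extension of operators *)

Lemma eventually_bounded (R : realType) (u : nat -> R) (M : R) (n0 : nat) :
  (forall n, 0 <= u n) -> (forall n, (n0 <= n)%N -> u n <= M) -> exists M', forall n, u n <= M'.
Proof.
move=> u0 hM; exists (\sum_(i < n0) u i + M) => n.
have s0 (P : pred 'I_n0) : 0 <= \sum_(i < n0 | P i) u i by apply: sumr_ge0 => i _.
have M0 : 0 <= M := le_trans (u0 n0) (hM n0 (leqnn n0)).
have [nn|nn] := ltnP n n0; last by have := hM n nn; have := s0 predT; lra.
by rewrite (bigD1 (Ordinal nn)) //= -addrA lerDl addr_ge0.
Qed.

Section RealSequences.
Variable R : realType.
Implicit Types (a b c e r : R) (n : nat).

Lemma harmonic_small c e : 0 < e ->
  exists N, forall n, (N <= n)%N -> c / n.+1%:R < e.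
Proof.
move=> e0; exists (Num.truncn (`|c| / e)) => n Nn.
have ce0 : 0 <= `|c| / e by rewrite divr_ge0 ?normr_ge0 // ltW.
have h : `|c| / e < n.+1%:R.
  apply: lt_le_trans (truncnS_gt _) _.
  by rewrite ler_nat ltnS.
rewrite ltr_pdivrMr ?ltr0n // (le_lt_trans (ler_norm c)) //.
by rewrite mulrC -ltr_pdivrMr.
Qed.

Lemma le_harmonic a b c : (forall n, a <= b + c / n.+1%:R) -> a <= b.
Proof.
move=> h; apply/ler_addgt0Pr => e e0.
have [N /(_ N (leqnn N)) hN] := harmonic_small c e0.
by rewrite (le_trans (h N)) // lerD2l ltW.
Qed.

Lemma geometric_small c r e : 0 <= r -> r < 1 -> 0 < e ->
  exists N, forall n, (N <= n)%N -> c * r ^+ n < e.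
Proof.
move=> r0 r1 e0.
(* A form of Bernoulli's inequality, which reduces geometric decay to harmonic decay. *)
have bern n : r ^+ n * (1 + n%:R * (1 - r)) <= 1.
  elim: n => [|n IH]; first by rewrite expr0 mul0r addr0 mulr1.
  have hn : r ^+ n <= 1 by rewrite exprn_ile1 // ltW.
  have hn0 : 0 <= r ^+ n by rewrite exprn_ge0.
  rewrite exprS -natr1; have := ler_wpM2l r0 IH.
  have : r * r ^+ n * (1 - r) <= 1 * (1 - r).
    by rewrite ler_wpM2r ?subr_ge0 ?(ltW r1) // mulr_ile1 // ltW.
  lra.
have [N HN] := harmonic_small (`|c| / (1 - r)) e0.
exists N => n Nn; apply: le_lt_trans (HN n Nn).
have r1' : 0 < 1 - r by rewrite subr_gt0.
rewrite (le_trans (ler_norm _)) // normrM (ger0_norm (exprn_ge0 _ r0)) -mulrA.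
rewrite ler_wpM2l ?normr_ge0 // -invfM -(@ler_pM2r _ ((1 - r) * n.+1%:R)) ?mulr_gt0 ?ltr0n //.
rewrite mulVf ?mulf_neq0 ?gt_eqF ?ltr0n //.
apply: le_trans (bern n); rewrite ler_wpM2l ?exprn_ge0 // -natr1; lra.
Qed.

End RealSequences.

Section Convergence.
Variables (R : realType) (V : lmodType R[i]) (ip : V -> V -> R[i]).
Hypothesis hip : is_hilbert ip.
Local Notation N := (hnorm ip).
Let hs := hilbert_semi hip.

(** The limit inherits the explicit rate: in [N (u n - l) <= N (u n - u m) + N (u m - l)], both
    [a m] and the last term become small as [m] grows. *)
Lemma cauchy_rate_cvg (u : nat -> V) (a : nat -> R) :
  (forall e, 0 < e -> exists n0, forall n, (n0 <= n)%N -> a n < e) ->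
  (forall m n, N (u m - u n) <= a m + a n) ->
  exists l, forall n, N (u n - l) <= a n.
Proof.
move=> ha hu; have [|l hl] := ip_complete hip (u := u).
  move=> e e0; have e2 : 0 < e / 2 by rewrite divr_gt0.
  have [n0 hn0] := ha _ e2; exists n0 => m n hm hn.
  apply: le_lt_trans (hu m n) _; have := hn0 _ hm; have := hn0 _ hn; lra.
exists l => n; apply/ler_addgt0Pr => e e0.
have e2 : 0 < e / 2 by rewrite divr_gt0.
have [n0 hn0] := ha _ e2; have [n1 hn1] := hl _ e2.
pose m := maxn n0 n1.
have h0 := hn0 m (leq_maxl _ _); have h1 := hn1 m (leq_maxr _ _).
have := ler_hnorm_split hs (u m) (u n) l; have := hu n m; lra.
Qed.

Lemma geometric_cvg (u : nat -> V) (c r : R) : 0 <= c -> 0 <= r -> r < 1 ->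
  (forall n, N (u n.+1 - u n) <= c * r ^+ n) ->
  exists l, forall n, N (u n - l) <= c / (1 - r) * r ^+ n.
Proof.
move=> c0 r0 r1 hu; have r1' : 0 < 1 - r by rewrite subr_gt0.
(* Keeping the subtracted term makes the induction close: [c / (1 - r) * r ^+ n] drops by exactly
   [c * r ^+ n] when [n] increases by one. *)
have tail n p : N (u (n + p)%N - u n) <= c / (1 - r) * r ^+ n - c / (1 - r) * r ^+ (n + p)%N.
  elim: p => [|p IH]; first by rewrite addn0 !subrr hnorm0.
  have := ler_hnorm_split hs (u (n + p)%N) (u (n + p.+1)%N) (u n).
  rewrite addnS exprS; have := hu (n + p)%N.
  have -> : c / (1 - r) * (r * r ^+ (n + p)) =
      c / (1 - r) * r ^+ (n + p) - c * r ^+ (n + p).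
    by field; rewrite gt_eqF.
  by lra.
have a0 n : 0 <= c / (1 - r) * r ^+ n by rewrite mulr_ge0 ?divr_ge0 ?exprn_ge0 // ltW.
apply: cauchy_rate_cvg; first by move=> e; exact: geometric_small.
move=> m n; case: (leqP n m) => [nm|/ltnW mn].
  by have := tail n (m - n)%N; rewrite subnKC //; have := a0 m; lra.
by have := tail m (n - m)%N; rewrite subnKC // hnormBC //; have := a0 n; lra.
Qed.

Record closed_subspace (A : V -> Prop) : Prop := {
  cs0 : A 0;
  cs_lin : forall (a : R[i]) x y, A x -> A y -> A (a *: x + y);
  cs_closed : forall x, (forall e, 0 < e -> exists y, A y /\ N (x - y) <= e) -> A x }.

Lemma cs_add A x y : closed_subspace A -> A x -> A y -> A (x + y).
Proof. by move=> hA Ax Ay; rewrite -[x]scale1r; apply: cs_lin. Qed.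

Lemma cs_scale A a x : closed_subspace A -> A x -> A (a *: x).
Proof. by move=> hA Ax; rewrite -[_ *: _]addr0; apply: cs_lin => //; exact: cs0. Qed.

Lemma cs_sub A x y : closed_subspace A -> A x -> A y -> A (x - y).
Proof. by move=> hA Ax Ay; rewrite addrC -scaleN1r; apply: cs_lin. Qed.

Lemma orthogonal_projection A (x : V) : closed_subspace A ->
  exists p, A p /\ forall n, A n -> ip (x - p) n = 0.
Proof.
move=> hA.
pose S := [set r : R | exists n, A n /\ r = N (x - n) ^+ 2]%classic.
have hS : has_inf S.
  split; first by exists (N (x - 0) ^+ 2); exists 0; split => //; exact: cs0.
  by exists 0 => _ [n [_ ->]]; exact: sqr_ge0.
pose d := inf S.
have dmin n : A n -> d <= N (x - n) ^+ 2.
  by move=> An; apply: ge_inf; [exact: hS.2|exists n].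
(* This slack is what the parallelogram law turns into the rate [1 / j.+1 + 1 / k.+1] for
   [N (u j - u k)], the midpoint being at squared distance at least [d] from [x]. *)
have minseq k : exists n, A n /\ N (x - n) ^+ 2 < d + 2^-1 * (1 / k.+1%:R) ^+ 2.
  have k0 : 0 < 2^-1 * (1 / k.+1%:R) ^+ 2 :> R.
    by rewrite mulr_gt0 ?invr_gt0 ?exprn_gt0 ?divr_gt0 ?ltr0n.
  by have [_ [n [An ->]] hn] := inf_adherent k0 hS; exists n.
have [u hu] := choice minseq.
have hk k : 0 < 1 / k.+1%:R :> R by rewrite divr_gt0 ?ltr0n.
have [||p hp] := @cauchy_rate_cvg u (fun k => 1 / k.+1%:R).
- by move=> e; exact: harmonic_small.
- move=> j k.
  have [Aj hj] := hu j; have [Ak hk'] := hu k.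
  have jp := hk j; have kp := hk k.
  rewrite -(ler_pXn2r (n := 2)) ?nnegrE ?(hnorm_ge0 ip) ?addr_ge0 ?(ltW jp) ?(ltW kp) //.
  have := hnorm_parallelogram hs (x - u j) (x - u k).
  have -> : x - u j - (x - u k) = u k - u j.
    by rewrite opprB addrC subrKA.
  have -> : x - u j + (x - u k) = (2%:R)%:C%C *: (x - (2%:R^-1)%:C%C *: (u j + u k)).
    rewrite scalerBr scalerA -rmorphM /= divff ?pnatr_eq0 // scale1r.
    by rewrite rmorph_nat scaler_nat mulr2n addrACA opprD.
  rewrite hnormZr // exprMn normr_nat (hnormBC hs (u j)).
  have := dmin ((2%:R^-1)%:C%C *: (u j + u k)) (cs_scale _ hA (cs_add hA Aj Ak)).
  have := mulr_gt0 jp kp.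
  set s := N (x - _) in hj *; set t := N (x - _) in hk' *; set w := N (x - _).
  set z := N (u k - u j).
  move: (1 / j.+1%:R) (1 / k.+1%:R) jp kp hj hk' => a b; lra.
have Ap : A p.
  apply: cs_closed hA _ _ => e e0; have [k0 h] := harmonic_small 1 e0.
  exists (u k0); split; first by case: (hu k0).
  by rewrite hnormBC // (le_trans (hp k0)) // ltW // h.
have minp n : A n -> N (x - p) ^+ 2 <= N (x - p - n) ^+ 2.
  move=> An; rewrite -[x - p - n]addrA -opprD.
  apply: le_trans (dmin _ (cs_add hA Ap An)).
  apply: (@le_harmonic _ _ _ (1 + N (x - p) + N (x - p) + 1)) => k.
  rewrite -(mul1r k.+1%:R^-1) mulrC.
  have [_ h1] := hu k; have h2 := hp k; have h3 := hk k.
  have k1 : 1 / k.+1%:R <= 1 :> R by rewrite ler_pdivrMr ?ltr0n // mul1r ler1n.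
  have := ler_hnorm_sqB hs (x - u k) (x - p).
  have := ler_hnorm_dist hs (x - u k) (x - p).
  have -> : x - u k - (x - p) = p - u k by rewrite opprB addrC subrKA.
  rewrite ler_norml (hnormBC hs p) => /andP[_].
  move: h1 h2 h3 k1.
  have := hnorm_ge0 ip (x - p); have := hnorm_ge0 ip (u k - p).
  have := hnorm_ge0 ip (x - u k).
  move: (N (x - u k)) (N (x - p)) (N (u k - p)) (1 / k.+1%:R) => a b w i a0 w0 b0.
  move=> h1 h2 h3 h4 h5 h6.
  have : i * i <= i * 1 by rewrite ler_wpM2l // ltW.
  have : w * (a + b) <= i * (1 + b + b) by apply: ler_pM => //; lra.
  lra.
have orth n : A n -> rip ip (x - p) n = 0.
  (* Moving [p] by [s] times [n] changes the squared distance by [s^2 N n ^+ 2 - 2 s q]. The [+ 1]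
     in the denominator makes this [- s^2 (N n ^+ 2 + 2)], so [s = 0], without separating the case
     [N n = 0]. *)
  move=> An; set q := rip _ _ _; pose s := q / (N n ^+ 2 + 1).
  have n0 : 0 < N n ^+ 2 + 1 by rewrite ltr_wpDl ?sqr_ge0.
  have := minp _ (cs_scale s%:C%C hA An).
  rewrite (hnormB_sq hs (x - p)) hnormZr // exprMn real_normK ?num_real // ripZr // -/q.
  have sE : q = s * (N n ^+ 2 + 1) by rewrite /s divfK // gt_eqF.
  rewrite {2}sE; have := sqr_ge0 s; have := sqr_ge0 (N n) => h1 h2 h3.
  have s0 : s ^+ 2 <= 0 by nra.
  have /eqP : s ^+ 2 = 0 by apply/eqP; rewrite eq_le s0 h2.
  by rewrite sqrf_eq0 => /eqP s00; move: sE; rewrite s00 mul0r.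
exists p; split => // n An; apply/eqP; rewrite eq_complex /= Im_rip //.
have := orth n An; have := orth _ (cs_scale 'i%C hA An); rewrite /rip => -> ->.
by rewrite eqxx.
Qed.

(** Continuity of [f] enters as closedness of its kernel, so that the part of [x0] orthogonal to the
    kernel exists; a multiple of it represents [f]. *)
Lemma riesz (f : V -> R[i]) :
  (forall a x y, f (a *: x + y) = a * f x + f y) ->
  closed_subspace (fun x => f x = 0) -> exists z, forall y, f y = ip y z.
Proof.
move=> flin hker.
have f0 : f 0 = 0 := cs0 hker.
have fZ a x : f (a *: x) = a * f x by rewrite -[a *: x]addr0 flin f0 addr0.
have [[x0 /eqP fx0]|h] := pselect (exists x, f x <> 0); last first.
  exists 0 => y; rewrite (ip0r hs); case: (eqVneq (f y) 0) => // /eqP fy.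
  by case: h; exists y.
have [p [fp hp]] := orthogonal_projection x0 hker.
set e := x0 - p in hp.
have fe : f e = f x0.
  by rewrite /e addrC -scaleN1r flin fp mulr0 add0r.
have ee : ip e e != 0.
  apply/eqP => /(ip_def hip) e0; move: fx0; rewrite -fe e0 f0 => /eqP; exact.
exists (conjc (f e / ip e e) *: e) => y.
have := hp (f e *: y + (- f y) *: e).
rewrite flin fZ mulrC mulNr subrr => /(_ erefl) h.
have : ip (f e *: y + - f y *: e) e = 0 by rewrite (si_conj hs) h conjc0.
rewrite (ipDl hs) !(ipZl hs) mulNr => /eqP; rewrite subr_eq0 => /eqP E.
by rewrite (ipZr hs) conjcK mulrAC E mulfK.
Qed.

End Convergence.

(** * Extension of densely defined operators, and adjoints *)

Section Operators.
Variables (R : realType) (V W : lmodType R[i]).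
Variables (ipV : V -> V -> R[i]) (ipW : W -> W -> R[i]).
Local Notation NV := (hnorm ipV).
Local Notation NW := (hnorm ipW).

Definition linmap (f : V -> W) := forall (a : R[i]) x y, f (a *: x + y) = a *: f x + f y.

Lemma linmapD f x y : linmap f -> f (x + y) = f x + f y.
Proof. by move=> hf; rewrite -[x]scale1r hf !scale1r. Qed.

Lemma linmap0 f : linmap f -> f 0 = 0.
Proof. by move=> hf; apply: (addrI (f 0)); rewrite -linmapD // !addr0. Qed.

Lemma linmapZ f a x : linmap f -> f (a *: x) = a *: f x.
Proof. by move=> hf; rewrite -[a *: x]addr0 hf linmap0 // addr0. Qed.

Lemma linmapB f x y : linmap f -> f (x - y) = f x - f y.
Proof. by move=> hf; rewrite addrC -scaleN1r hf scaleN1r addrC. Qed.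

Lemma bounded_op_bound f : bounded_op ipV ipW f ->
  exists M, 0 < M /\ forall x, NW (f x) <= M * NV x.
Proof.
case=> _ [M hM]; exists (`|M| + 1); split; first by rewrite ltr_wpDl.
move=> x; apply: le_trans (hM x) _; rewrite ler_wpM2r ?(hnorm_ge0 ipV) //.
by rewrite (le_trans (ler_norm M)) // lerDl.
Qed.

Hypotheses (hV : semi_inner ipV) (hW : is_hilbert ipW).
Let hWs := hilbert_semi hW.

Section Extension.
Variables (D : V -> W -> Prop) (M : R).
Hypothesis M0 : 0 <= M.
Hypothesis Dlin : forall a x y x' y', D x x' -> D y y' -> D (a *: x + y) (a *: x' + y').
Hypothesis Dbound : forall x y, D x y -> NW y <= M * NV x.
Hypothesis Ddense : forall x e, 0 < e -> exists x' y', D x' y' /\ NV (x - x') <= e.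

Let clos x z := forall e, 0 < e -> exists x' y', D x' y' /\ NV (x - x') <= e /\ NW (z - y') <= e.

Let D_clos x y : D x y -> clos x y.
Proof. by move=> h e e0; exists x, y; rewrite !subrr !hnorm0 // ltW. Qed.

Let clos_lin a x y x' y' : clos x x' -> clos y y' -> clos (a *: x + y) (a *: x' + y').
Proof.
move=> h1 h2 e e0; pose k := normc a + 1.
have a0 := normc_ge0 a.
have k0 : 0 < k by rewrite ltr_wpDl.
have ek : 0 < e / k by rewrite divr_gt0.
have [x1 [x1' [D1 [d1 d1']]]] := h1 _ ek; have [x2 [x2' [D2 [d2 d2']]]] := h2 _ ek.
exists (a *: x1 + x2), (a *: x1' + x2'); split; first exact: Dlin.
have eE : normc a * (e / k) + e / k = e by rewrite /k; field; rewrite gt_eqF.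
split; rewrite opprD addrACA -scalerBr -eE.
  by rewrite (le_trans (ler_hnormD hV _ _)) // hnormZ // lerD // ler_wpM2l.
by rewrite (le_trans (ler_hnormD hWs _ _)) // hnormZ // lerD // ler_wpM2l.
Qed.

Let clos_bound x y : clos x y -> NW y <= M * NV x.
Proof.
move=> h; apply: (@le_harmonic _ _ _ (M + 1)) => n.
have n0 : 0 < n.+1%:R^-1 :> R by rewrite invr_gt0 ltr0n.
have [x' [y' [Dxy [d1 d2]]]] := h _ n0.
have h1 := Dbound Dxy; have h2 := ler_hnormD hWs (y - y') y'.
have h3 := ler_hnormD hV (x' - x) x.
rewrite !subrK in h2 h3; rewrite (hnormBC hV) in h3.
move: n.+1%:R^-1 n0 d1 d2 => i n0 d1 d2.
have : M * NV x' <= M * (i + NV x) by rewrite ler_wpM2l // (le_trans h3) // lerD2r.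
rewrite mulrDr mulrDl mul1r; lra.
Qed.

Let clos_total x : exists y, clos x y.
Proof.
have seqx n : exists p : V * W, D p.1 p.2 /\ NV (x - p.1) <= 1 / n.+1%:R.
  have n0 : 0 < 1 / n.+1%:R :> R by rewrite divr_gt0 ?ltr0n.
  by have [x' [y' h]] := Ddense x n0; exists (x', y').
have [u hu] := choice seqx.
have Dsub a b a' b' : D a a' -> D b b' -> D (a - b) (a' - b').
  by move=> h h'; rewrite (addrC a) (addrC a') -(scaleN1r b) -(scaleN1r b'); exact: Dlin.
have [||l hl] := @cauchy_rate_cvg _ _ _ hW (fun n => (u n).2) (fun n => M / n.+1%:R).
- by move=> e; exact: harmonic_small.
- move=> m n; have [Dm dm] := hu m; have [Dn dn] := hu n.
  apply: le_trans (Dbound (Dsub _ _ _ _ Dm Dn)) _; rewrite -mulrDr ler_wpM2l //.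
  move: dm dn; rewrite !div1r => dm dn.
  by rewrite (le_trans (ler_hnorm_split hV x _ _)) // (hnormBC hV) lerD.
exists l => e e0; have [n hn] := harmonic_small (M + 1) e0.
have [Dn dn] := hu n; exists (u n).1, (u n).2; split => //.
have hnn := hn n (leqnn n).
have n0 : 0 < n.+1%:R^-1 :> R by rewrite invr_gt0 ltr0n.
have hM : 0 <= M * n.+1%:R^-1 by rewrite mulr_ge0 // ltW.
have hln := hl n; rewrite (hnormBC hWs) in hln; rewrite div1r in dn.
by move: n.+1%:R^-1 n0 hM hln hnn dn => i n0 hM hln hnn dn; split; lra.
Qed.

(** [D] is a linear relation rather than a map: the bound forces one value per argument, so an
    operator can be prescribed on sums or decompositions without checking independence of the
    representation. Completeness of [W] makes the closure [clos] of [D] total. *)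
Lemma extend_op : exists f : V -> W,
  linmap f /\ (forall x, NW (f x) <= M * NV x) /\ forall x y, D x y -> f x = y.
Proof.
have [f hf] := choice clos_total.
have funi x y : clos x y -> f x = y.
  move=> h; apply: (hnorm_small_eq hW) => e e0.
  have := clos_lin (-1) h (hf x); rewrite !scaleN1r => /clos_bound.
  rewrite [- x + x]addNr hnorm0 // mulr0 addrC => /le_trans; apply; exact: ltW.
exists f; split; last split.
- by move=> a x y; apply: funi; apply: clos_lin.
- by move=> x; apply: clos_bound.
- by move=> x y /D_clos; exact: funi.
Qed.

End Extension.

Lemma graph_op (D : V -> W -> Prop) M : 0 <= M ->
  (forall a x y x' y', D x x' -> D y y' -> D (a *: x + y) (a *: x' + y')) ->
  (forall x y, D x y -> NW y <= M * NV x) ->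
  (forall x, exists y, D x y) -> exists f : V -> W,
  linmap f /\ (forall x, NW (f x) <= M * NV x) /\ forall x, D x (f x).
Proof.
move=> M0 Dlin Dbound Dtot.
have [|f [h1 [h2 h3]]] := extend_op M0 Dlin Dbound.
  move=> x e e0; have [y Dxy] := Dtot x; exists x, y; split => //.
  by rewrite subrr hnorm0 // ltW.
exists f; split => //; split => // x; have [y Dxy] := Dtot x; by rewrite (h3 _ _ Dxy).
Qed.

End Operators.

Lemma adjoint_op (R : realType) (V W : lmodType R[i]) (ipV : V -> V -> R[i])
    (ipW : W -> W -> R[i]) (E : V -> W) :
  is_hilbert ipV -> is_hilbert ipW -> bounded_op ipV ipW E ->
  exists F : W -> V, bounded_op ipW ipV F /\ forall x y, ipW (E x) y = ipV x (F y).
Proof.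
move=> hV hW bE; have [M [M0 hM]] := bounded_op_bound bE.
have hVs := hilbert_semi hV; have hWs := hilbert_semi hW.
have linE : linmap E by case: bE.
have [||||F [Flin [FM hF]]] := @graph_op _ _ _ ipW ipV hWs hV
  (fun w z => forall y, ipW (E y) w = ipV y z) M.
- exact: ltW.
- by move=> a x y x' y' h1 h2 z; rewrite (ipDr hWs) (ipDr hVs) (ipZr hWs) (ipZr hVs) h1 h2.
- move=> w z h; have [z0|z0] := eqVneq (hnorm ipV z) 0.
    by rewrite z0 mulr_ge0 ?(hnorm_ge0 ipW) // ltW.
  have zp : 0 < hnorm ipV z by rewrite lt_def z0 hnorm_ge0.
  rewrite -(ler_pM2r zp) -expr2 hnorm_sq // /rip -h.
  apply: le_trans (rip_le hWs _ _) _; rewrite mulrAC ler_wpM2r ?(hnorm_ge0 ipW) //.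
- move=> w; apply: (riesz hV) => [a x y|].
    by rewrite linE ipDl // ipZl.
  split; first by rewrite linmap0 // ip0l.
    by move=> a x y hx hy; rewrite linE (ipDl hWs) (ipZl hWs) hx hy mulr0 addr0.
  move=> x hx; have small e : 0 < e -> `|rip ipW (E x) w| <= e /\ `|complex.Im (ipW (E x) w)| <= e.
    move=> e0; pose k := M * hnorm ipW w + 1.
    have k0 : 0 < k by rewrite ltr_wpDl // mulr_ge0 ?(hnorm_ge0 ipW) // ltW.
    have [y [hy dy]] := hx _ (divr_gt0 e0 k0).
    have Exy : ipW (E x) w = ipW (E (x - y)) w by rewrite linmapB // (ipBl hWs) hy subr0.
    have bnd : hnorm ipW (E (x - y)) * hnorm ipW w <= e.
      have h1 : hnorm ipW (E (x - y)) <= M * (e / k).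
        by rewrite (le_trans (hM _)) // ler_wpM2l // ltW.
      apply: le_trans (ler_wpM2r (hnorm_ge0 ipW _) h1) _.
      rewrite mulrAC mulrCA ger_pMr // ler_pdivrMr // mul1r /k lerDl //.
    by rewrite /rip Exy; split; apply: le_trans bnd; [exact: rip_abs|exact: Im_ip_abs].
  apply/eqP; rewrite eq_complex /=; apply/andP.
  by split; rewrite -normr_le0; apply/ler_addgt0Pr => e /small [h1 h2]; rewrite add0r.
by exists F; split => //; split => //; exists M.
Qed.

(** * Square roots of positive operators *)

Section SquareRoot.
Variables (R : realType) (V : lmodType R[i]) (ip : V -> V -> R[i]).
Hypothesis hV : is_hilbert ip.
Local Notation N := (hnorm ip).
Let hs := hilbert_semi hV.

Variables (S : V -> V) (r : R).
Hypotheses (Slin : linmap S) (Ssym : forall x y, rip ip (S x) y = rip ip x (S y)).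
Hypotheses (r0 : 0 <= r) (r1 : r < 1) (Sbound : forall x, N (S x) <= r * N x).

Let half : R[i] := (2^-1 : R)%:C%C.
(** Picard iteration from [0] for [Z = (S + Z Z) / 2], which is the equation [(1 - Z)^2 = 1 - S]. *)
Let Y := fix Y n x := if n is m.+1 then half *: (S x + Y m (Y m x)) else 0.

Let half_norm x : N (half *: x) = 2^-1 * N x.
Proof. by rewrite hnormZr // ger0_norm // invr_ge0. Qed.

Let Ylin n : linmap (Y n).
Proof.
elim: n => [|n IH] a x y /=; first by rewrite scaler0 addr0.
by rewrite Slin !IH scalerA mulrC -scalerA -scalerDr; congr (half *: _); rewrite scalerDr addrACA.
Qed.

Let Ysym n x y : rip ip (Y n x) y = rip ip x (Y n y).
Proof.
elim: n x y => [|n IH] x y /=; first by rewrite /rip (ip0l hs) (ip0r hs).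
by rewrite (ripZl hs) (ripZr hs) (ripDl hs) (ripDr hs) Ssym !IH.
Qed.

Let Ybound n x : N (Y n x) <= r * N x.
Proof.
elim: n x => [|n IH] x /=; first by rewrite hnorm0 // mulr_ge0 ?hnorm_ge0.
rewrite half_norm; have := ler_hnormD hs (S x) (Y n (Y n x)).
have h1 := Sbound x; have h2 := IH x; have h3 := IH (Y n x).
have : r * N (Y n x) <= 1 * N (Y n x) by rewrite ler_wpM2r ?hnorm_ge0 // ltW.
lra.
Qed.

(** With [a = Y n.+1 x] and [b = Y n x], the difference [Y n.+1 a - Y n b] splits as
    [Y n.+1 (a - b) + (Y n.+1 b - Y n b)]. Each part obeys the induction hypothesis with one more
    factor [r], and the iterates never have to commute. *)
Let Ystep n x : N (Y n.+1 x - Y n x) <= r * N x * r ^+ n.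
Proof.
elim: n x => [|n IH] x.
  rewrite expr0 mulr1 /= subr0 addr0 half_norm; have := Sbound x.
  have := hnorm_ge0 ip (S x); lra.
set a := Y n.+1 x; set b := Y n x.
have -> : Y n.+2 x - a = half *: ((Y n.+1 a - Y n.+1 b) + (Y n.+1 b - Y n b)).
  rewrite [Y n.+2 x]/= -/a {2}/a /= -/b -scalerBr; congr (_ *: _); zmod.
rewrite half_norm.
have := ler_hnormD hs (Y n.+1 a - Y n.+1 b) (Y n.+1 b - Y n b).
rewrite -linmapB //; have h1 := Ybound n.+1 (a - b); have h2 := IH b.
have h3 : r * N (a - b) <= r * (r * N x * r ^+ n) by rewrite ler_wpM2l // IH.
have h4 : r * N b * r ^+ n <= r * (r * N x) * r ^+ n.
  by rewrite ler_wpM2r ?exprn_ge0 // ler_wpM2l // Ybound.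
have -> : r * N x * r ^+ n.+1 = r * (r * N x) * r ^+ n by rewrite exprS; ring.
have E : r * (r * N x * r ^+ n) = r * (r * N x) * r ^+ n by ring.
rewrite E in h3; lra.
Qed.

Let le0_geometric a c : (forall n, a <= c * r ^+ n) -> a <= 0.
Proof.
move=> h; apply/ler_addgt0Pr => e e0; rewrite add0r.
have [n /(_ n (leqnn n)) hn] := geometric_small c r0 r1 e0.
by rewrite (le_trans (h n)) // ltW.
Qed.

(* [1 - Z] is the square root of [1 - S]. *)
Lemma sqrt_iteration : exists Z : V -> V,
  [/\ linmap Z, forall x y, rip ip (Z x) y = rip ip x (Z y),
      forall x, N (Z x) <= r * N x & forall x, Z x + Z x = S x + Z (Z x)].
Proof.
pose B := r / (1 - r).
have B0 : 0 <= B by rewrite divr_ge0 // subr_ge0 ltW.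
have cvg x : exists l, forall n, N (Y n x - l) <= B * N x * r ^+ n.
  have := geometric_cvg hV (mulr_ge0 r0 (hnorm_ge0 ip x)) r0 r1 (fun n => Ystep n x).
  by rewrite mulrAC -/B.
have [Z hZ] := choice cvg.
have Zsmall x y c : (forall n, N (x - y) <= c * r ^+ n) -> x = y.
  move=> h; apply: (hnorm_small_eq hV) => e e0.
  by rewrite (le_trans (le0_geometric h)) // ltW.
have Zbound x : N (Z x) <= r * N x.
  rewrite -subr_le0; apply: (@le0_geometric _ (B * N x)) => n.
  have := ler_hnormD hs (Z x - Y n x) (Y n x); rewrite subrK (hnormBC hs).
  have := hZ x n; have := Ybound n x; lra.
exists Z; split=> //.
- move=> a x y; apply: (@Zsmall _ _ (B * N (a *: x + y) + normc a * (B * N x) + B * N y)) => n.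
  have -> : Z (a *: x + y) - (a *: Z x + Z y) =
    - (Y n (a *: x + y) - Z (a *: x + y)) + (a *: (Y n x - Z x) + (Y n y - Z y)).
    rewrite Ylin scalerBr; zmod.
  apply: le_trans (ler_hnormD hs _ _) _; rewrite (hnorm_opp hs) !mulrDl -addrA lerD ?hZ //.
  apply: le_trans (ler_hnormD hs _ _) _; rewrite hnormZ // lerD ?hZ //.
  by rewrite -mulrA ler_wpM2l // normc_ge0.
- move=> x y; apply/eqP; rewrite -subr_eq0 -normr_le0.
  apply: (@le0_geometric _ (B * N x * N y + N x * (B * N y))) => n.
  have -> : rip ip (Z x) y - rip ip x (Z y) = rip ip x (Y n y - Z y) - rip ip (Y n x - Z x) y.
    rewrite (ripBr hs) (ripBl hs) Ysym; ring.
  rewrite (le_trans (ler_normB _ _)) // addrC mulrDl lerD //.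
    by rewrite (le_trans (rip_abs hs _ _)) // mulrAC ler_wpM2r ?hnorm_ge0.
  by rewrite (le_trans (rip_abs hs _ _)) // -mulrA ler_wpM2l ?hnorm_ge0.
move=> x; apply: (@Zsmall _ _ (2 * (B * N x) + r * (B * N x) + B * N (Z x))) => n.
have -> : Z x + Z x - (S x + Z (Z x)) = (Y n (Y n x - Z x) + (Y n (Z x) - Z (Z x)))
    - ((Y n.+1 x - Z x) + (Y n.+1 x - Z x)).
  have -> : S x = Y n.+1 x + Y n.+1 x - Y n (Y n x).
    have h2 : 2^-1 + 2^-1 = 1 :> R by lra.
    rewrite /= -scalerDl -rmorphD /= h2 scale1r; zmod.
  rewrite (linmapB _ _ (Ylin n)); zmod.
have hn1 : N (Y n.+1 x - Z x) <= B * N x * r ^+ n.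
  apply: le_trans (hZ x n.+1) _; apply: ler_wpM2l; first by rewrite mulr_ge0 ?hnorm_ge0.
  by rewrite exprS ler_piMl ?exprn_ge0 // ltW.
have h1 := ler_hnormB hs (Y n (Y n x - Z x) + (Y n (Z x) - Z (Z x)))
  ((Y n.+1 x - Z x) + (Y n.+1 x - Z x)).
have h2 := ler_hnormD hs (Y n (Y n x - Z x)) (Y n (Z x) - Z (Z x)).
have h3 := ler_hnormD hs (Y n.+1 x - Z x) (Y n.+1 x - Z x).
have h4 := hZ (Z x) n.
have h5 : N (Y n (Y n x - Z x)) <= r * (B * N x * r ^+ n).
  by rewrite (le_trans (Ybound _ _)) // ler_wpM2l.
lra.
Qed.

End SquareRoot.

(** * Polar decomposition of operators bounded below *)

Section Polar.
Variables (R : realType) (V W : lmodType R[i]).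
Variables (ip : V -> V -> R[i]) (ipW : W -> W -> R[i]).
Hypotheses (hV : is_hilbert ip) (hW : is_hilbert ipW).
Local Notation N := (hnorm ip).
Let hs := hilbert_semi hV.
Let hsW := hilbert_semi hW.

(** [Q] is a square root of [k^2 F E], where [F] is the adjoint of [E], so [N (Q x) ^+ 2 = <Q (Q x),
    x> = k^2 |E x|^2]. The choice [k = 1 / M] places [k^2 F E] between [(k c)^2] and [1]; then
    [S = 1 - k^2 F E] is positive of norm less than one and the iteration applies. *)
Lemma polar_decomposition (E : V -> W) (c : R) : bounded_op ip ipW E ->
  0 < c -> (forall x, c * N x <= hnorm ipW (E x)) ->
  exists (Q g : V -> V) (k : R), [/\ bounded_op ip ip Q, bounded_op ip ip g,
    cancel Q g, cancel g Q & 0 < k /\ forall x, N (Q x) = k * hnorm ipW (E x)].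
Proof.
move=> bE c0 hc; have [M [M0 hM]] := bounded_op_bound bE.
have Elin : linmap E by case: bE.
have [F [[Flin _] hF]] := adjoint_op hV hW bE.
pose k := M^-1; have k0 : 0 < k by rewrite invr_gt0.
pose S x := x - (k ^+ 2)%:C%C *: F (E x).
have Slin : linmap S.
  move=> a x y; rewrite /S Elin Flin scalerDr opprD addrACA scalerA mulrC -scalerA.
  by rewrite scalerBr.
have ipS x y : ip (S x) y = ip x y - (k ^+ 2)%:C%C * ipW (E x) (E y).
  rewrite /S (ipBl hs) (ipZl hs); congr (_ - _ * _).
  by rewrite (si_conj hs) -hF -(si_conj hsW).
pose q x := N x ^+ 2 - k ^+ 2 * hnorm ipW (E x) ^+ 2.
have ripS x : complex.Re (ip (S x) x) = q x.
  rewrite ipS raddfB /= /q !hnorm_sq // /rip; congr (_ - _).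
  by case: (ipW (E x) (E x)) => ? ? /=; ring.
(* Capping at [1/2] keeps the contraction constant [1 - d] nonnegative. *)
pose d := Num.min ((k * c) ^+ 2) 2^-1.
have d0 : 0 < d by rewrite lt_min exprn_gt0 ?mulr_gt0 //= invr_gt0.
have d1 : d <= 2^-1 by rewrite ge_min lexx orbT.
pose ipS' x y := ip (S x) y.
have hS' : semi_inner ipS'.
  split=> [a x y z|x y|x]; rewrite /ipS'.
  - by rewrite Slin (si_lin hs).
  - have conj_subZ (a : R) u v : conjc u - a%:C%C * conjc v = conjc (u - a%:C%C * v).
      by case: u v => [u1 u2] [v1 v2]; apply/eqP; rewrite eq_complex /=; apply/andP; split;
        apply/eqP; ring.
    by rewrite !ipS (si_conj hs x y) (si_conj hsW (E x)) conj_subZ.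
  - rewrite ripS /q subr_ge0 -exprMn lerXn2r ?nnegrE ?mulr_ge0 ?hnorm_ge0 ?(ltW k0) //.
    by rewrite /k mulrC ler_pdivrMr // mulrC.
have nS' x : hnorm ipS' x ^+ 2 <= (1 - d) * N x ^+ 2.
  rewrite hnorm_sq // /rip ripS /q mulrBl mul1r lerD2l lerN2.
  have h1 : d * N x ^+ 2 <= (k * c) ^+ 2 * N x ^+ 2.
    by rewrite ler_wpM2r ?sqr_ge0 // ge_min lexx.
  rewrite (le_trans h1) // -!exprMn lerXn2r ?nnegrE ?mulr_ge0 ?hnorm_ge0 ?(ltW k0) ?(ltW c0) //.
  by rewrite -mulrA ler_wpM2l // ltW.
(* Cauchy-Schwarz for the form [<S x, y>] upgrades the quadratic bound [nS'] to a norm bound,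
   because [N (S x) ^+ 2] is the value of that form at [x] and [S x]. *)
have Sbound x : N (S x) <= (1 - d) * N x.
  have [z|z] := eqVneq (N (S x)) 0; first by rewrite z mulr_ge0 ?hnorm_ge0 //; lra.
  have zp : 0 < N (S x) by rewrite lt_def z hnorm_ge0.
  have := rip_le hS' x (S x); rewrite /rip /ipS' -/(rip ip _ _) -hnorm_sq // => h.
  have {}h : (N (S x) ^+ 2) ^+ 2 <= ((1 - d) * N x ^+ 2) * ((1 - d) * N (S x) ^+ 2).
    apply: (@le_trans _ _ ((hnorm ipS' x * hnorm ipS' (S x)) ^+ 2)).
      by rewrite lerXn2r ?nnegrE ?mulr_ge0 ?hnorm_ge0 ?sqr_ge0.
    by rewrite exprMn ler_pM ?sqr_ge0.
  rewrite -(ler_pXn2r (n := 2)) ?nnegrE ?mulr_ge0 ?hnorm_ge0 //; last by lra.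
  have z2 : 0 < N (S x) ^+ 2 by rewrite exprn_gt0.
  rewrite -(ler_pM2r z2); move: h; rewrite expr2 exprMn.
  by congr (_ <= _); ring.
have r0 : 0 <= 1 - d by lra.
have r1 : 1 - d < 1 by lra.
have Ssym x y : rip ip (S x) y = rip ip x (S y).
  by rewrite (ripC hs x) /rip; have := si_conj hS' x y; rewrite /ipS' => ->; case: (ip (S x) y).
have [Z [Zlin Zsym Zbound Zeq]] := sqrt_iteration hV Slin Ssym r0 r1 Sbound.
pose Q x := x - Z x.
have Qlin : linmap Q by move=> a x y; rewrite /Q Zlin scalerBr opprD addrACA.
have QQ x : Q (Q x) = (k ^+ 2)%:C%C *: F (E x).
  have -> : (k ^+ 2)%:C%C *: F (E x) = x - S x by rewrite /S; zmod.
  have -> : S x = Z x + Z x - Z (Z x) by rewrite Zeq; zmod.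
  rewrite /Q linmapB //; zmod.
have Qnorm x : N (Q x) = k * hnorm ipW (E x).
  apply/eqP; rewrite -(@eqrXn2 _ 2) ?mulr_ge0 ?hnorm_ge0 ?(ltW k0) //; apply/eqP.
  have -> : N (Q x) ^+ 2 = rip ip (Q (Q x)) x.
    by rewrite hnorm_sq // {2}/Q (ripBr hs) -Zsym -(ripBl hs).
  rewrite QQ (ripZl hs) exprMn hnorm_sq // /rip hF.
  by rewrite (si_conj hs) -hF; case: (ipW _ _).
have Qlow x : d * N x <= N (Q x).
  have := ler_hnormD hs (Q x) (Z x); rewrite subrK; have := Zbound x; lra.
(* [Q x = y] reads [x = y + Z x]; iterating this from [0] produces the Neumann series. *)
have Qsurj y : exists x, Q x = y.
  pose u := fix u n := if n is m.+1 then y + Z (u m) else 0.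
  have ustep n : N (u n.+1 - u n) <= N y * (1 - d) ^+ n.
    elim: n => [|n IH]; first by rewrite /= linmap0 // addr0 subr0 expr0 mulr1.
    have -> : u n.+2 - u n.+1 = Z (u n.+1 - u n) by rewrite linmapB //=; zmod.
    by rewrite (le_trans (Zbound _)) // exprS mulrCA ler_wpM2l.
  have [x hx] := geometric_cvg hV (hnorm_ge0 ip y) r0 r1 ustep.
  exists x; apply: (hnorm_small_eq hV) => e e0.
  pose c1 := N y / (1 - (1 - d)).
  have [n /(_ n (leqnn n)) hn] := geometric_small (c1 + c1) r0 r1 e0.
  rewrite /c1 in hn.
  have -> : Q x - y = Z (u n - x) - (u n.+1 - x).
    rewrite /Q linmapB //=; zmod.
  have h1 := hx n; have h2 := hx n.+1; have h3 := Zbound (u n - x).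
  have h4 := ler_hnormB hs (Z (u n - x)) (u n.+1 - x).
  have c1_ge0 : 0 <= N y / (1 - (1 - d)) by rewrite divr_ge0 ?hnorm_ge0 //; lra.
  have h5 : (1 - d) * N (u n - x) <= 1 * N (u n - x) by rewrite ler_wpM2r ?hnorm_ge0 // ltW.
  have h6 : N y / (1 - (1 - d)) * (1 - d) ^+ n.+1 <= N y / (1 - (1 - d)) * (1 - d) ^+ n.
    by rewrite ler_wpM2l // exprS ler_piMl ?exprn_ge0 // ltW.
  rewrite mulrDl in hn; lra.
have Qinj : injective Q.
  move=> x y xy; apply: (hnorm_small_eq hV) => e e0.
  have := Qlow (x - y); rewrite linmapB // xy subrr hnorm0 //.
  by rewrite pmulr_rle0 // => /le_trans; apply; exact: ltW.
have [g hg] := choice Qsurj.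
have Qg : cancel Q g by move=> x; apply: Qinj; rewrite hg.
exists Q, g, k; split => //.
  by split => //; exists (k * M) => x; rewrite Qnorm -mulrA ler_wpM2l // ltW.
split; first by move=> a x y; apply: Qinj; rewrite Qlin !hg.
by exists d^-1 => x; rewrite mulrC ler_pdivlMr // mulrC -{2}[x]hg Qlow.
Qed.

End Polar.

(** * Similarity and uniform boundedness *)

Section Kernels.
Variables (R : realType) (V W : lmodType R[i]).
Variables (ipV : V -> V -> R[i]) (ipW : W -> W -> R[i]).
Hypotheses (hV : is_hilbert ipV) (hW : is_hilbert ipW).
Let hVs := hilbert_semi hV.
Let hWs := hilbert_semi hW.

Lemma closed_kernel (G : V -> W) : bounded_op ipV ipW G ->
  closed_subspace ipV (fun x => G x = 0).
Proof.
move=> bG; have [M [M0 hM]] := bounded_op_bound bG; have Glin : linmap G by case: bG.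
split; first exact: linmap0.
  by move=> a x y hx hy; rewrite Glin hx hy scaler0 addr0.
move=> x hx; apply: (hnorm_small0 hW) => e e0.
have [y [hy dy]] := hx (e / M) (divr_gt0 e0 M0).
have -> : G x = G (x - y) by rewrite (linmapB _ _ Glin) hy subr0.
by rewrite (le_trans (hM _)) // mulrC -ler_pdivlMr.
Qed.

Lemma closed_subspaceI (A B : V -> Prop) : closed_subspace ipV A -> closed_subspace ipV B ->
  closed_subspace ipV (fun x => A x /\ B x).
Proof.
move=> hA hB; split; first by split; [exact: (cs0 hA)|exact: (cs0 hB)].
  by move=> a x y [? ?] [? ?]; split; [exact: (cs_lin hA)|exact: (cs_lin hB)].
move=> x h; split; [apply: (cs_closed hA)|apply: (cs_closed hB)] => e /h.
  by case=> y [[? _] ?]; exists y.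
by case=> y [[_ ?] ?]; exists y.
Qed.

Lemma closed_subspace_bigI (I : Type) (A : I -> V -> Prop) :
  (forall i, closed_subspace ipV (A i)) -> closed_subspace ipV (fun x => forall i, A i x).
Proof.
move=> hA; split; first by move=> i; exact: (cs0 (hA i)).
  by move=> a x y hx hy i; apply: (cs_lin (hA i)).
move=> x h i; apply: (cs_closed (hA i)) => e /h [y [hy ?]]; by exists y.
Qed.

Lemma bounded_opB (F G : V -> W) : bounded_op ipV ipW F -> bounded_op ipV ipW G ->
  bounded_op ipV ipW (fun x => F x - G x).
Proof.
case=> Flin [MF hF] [Glin [MG hG]]; split.
  by move=> a x y; rewrite Flin Glin scalerBr; zmod.
exists (MF + MG) => x; rewrite (le_trans (ler_hnormB hWs _ _)) // mulrDl lerD //.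
Qed.

End Kernels.

Lemma bounded_op_comp (R : realType) (U V W : lmodType R[i]) (ipU : U -> U -> R[i])
    (ipV : V -> V -> R[i]) (ipW : W -> W -> R[i]) (F : V -> W) (G : U -> V) :
  bounded_op ipV ipW F -> bounded_op ipU ipV G -> bounded_op ipU ipW (fun x => F (G x)).
Proof.
move=> bF [Glin [MG hG]]; have [M [M0 hM]] := bounded_op_bound bF.
case: bF => Flin _; split; first by move=> a x y; rewrite Glin Flin.
by exists (M * MG) => x; rewrite (le_trans (hM _)) // -mulrA ler_wpM2l // ltW.
Qed.

Section Product.
Variables (R : realType) (V W : lmodType R[i]).
Variables (ipV : V -> V -> R[i]) (ipW : W -> W -> R[i]).
Hypotheses (hV : is_hilbert ipV) (hW : is_hilbert ipW).
Let hVs := hilbert_semi hV.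
Let hWs := hilbert_semi hW.

Definition prod_ip (p q : V * W) : R[i] := ipV p.1 q.1 + ipW p.2 q.2.

Lemma prod_semi : semi_inner prod_ip.
Proof.
split=> [a x y z|x y|x]; rewrite /prod_ip /=.
- by rewrite (si_lin hVs) (si_lin hWs) mulrDr addrACA.
- by rewrite rmorphD /= -(si_conj hVs) -(si_conj hWs).
- by rewrite raddfD addr_ge0 //; [exact: (si_pos hVs)|exact: (si_pos hWs)].
Qed.

Lemma prod_hnorm_sq p : hnorm prod_ip p ^+ 2 = hnorm ipV p.1 ^+ 2 + hnorm ipW p.2 ^+ 2.
Proof.
rewrite (hnorm_sq prod_semi) (hnorm_sq hVs) (hnorm_sq hWs).
by rewrite /rip /prod_ip raddfD.
Qed.

Lemma le_prod_hnorm1 p : hnorm ipV p.1 <= hnorm prod_ip p.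
Proof.
by rewrite -(ler_pXn2r (n := 2)) ?nnegrE ?hnorm_ge0 // prod_hnorm_sq lerDl sqr_ge0.
Qed.

Lemma le_prod_hnorm2 p : hnorm ipW p.2 <= hnorm prod_ip p.
Proof.
by rewrite -(ler_pXn2r (n := 2)) ?nnegrE ?hnorm_ge0 // prod_hnorm_sq lerDr sqr_ge0.
Qed.

Lemma prod_hnorm_le p : hnorm prod_ip p <= hnorm ipV p.1 + hnorm ipW p.2.
Proof.
rewrite -(ler_pXn2r (n := 2)) ?nnegrE ?addr_ge0 ?hnorm_ge0 // prod_hnorm_sq.
have := hnorm_ge0 ipV p.1; have := hnorm_ge0 ipW p.2; nra.
Qed.

Lemma prod_hilbert : is_hilbert prod_ip.
Proof.
have hs := prod_semi; split; [exact: si_lin hs|exact: si_conj hs| | |].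
- by move=> x; split; [exact: si_pos|exact: ip_Im].
- move=> p p0; have n0 : hnorm prod_ip p = 0 by rewrite /hnorm p0 sqrtr0.
  have h1 := le_prod_hnorm1 p; have h2 := le_prod_hnorm2 p; rewrite n0 in h1 h2.
  case: p {p0 n0} h1 h2 => x y /= h1 h2; congr (_, _).
    by apply: (hnorm_eq0 hV); apply/eqP; rewrite eq_le h1 hnorm_ge0.
  by apply: (hnorm_eq0 hW); apply/eqP; rewrite eq_le h2 hnorm_ge0.
- move=> u hu.
  have [|x hx] := ip_complete hV (u := fun n => (u n).1).
    move=> e /hu[n0 h]; exists n0 => m n hm hn.
    by apply: le_lt_trans (h m n hm hn); exact: (le_prod_hnorm1 (u m - u n)).
  have [|y hy] := ip_complete hW (u := fun n => (u n).2).
    move=> e /hu[n0 h]; exists n0 => m n hm hn.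
    by apply: le_lt_trans (h m n hm hn); exact: (le_prod_hnorm2 (u m - u n)).
  exists (x, y) => e e0; have e2 : 0 < e / 2 by rewrite divr_gt0.
  have [n1 h1] := hx _ e2; have [n2 h2] := hy _ e2.
  exists (maxn n1 n2) => n; rewrite geq_max => /andP[/h1 {}h1 /h2 {}h2].
  apply: le_lt_trans (prod_hnorm_le (u n - (x, y))) _ => /=; lra.
Qed.

End Product.

Section Similarity.
Variables (R : realType) (H K : lmodType R[i]).
Variables (ip : H -> H -> R[i]) (ipK : K -> K -> R[i]).
Hypotheses (hH : is_hilbert ip) (hK : is_hilbert ipK).
Let hs := hilbert_semi hH.
Let hKs := hilbert_semi hK.
Variables (I : Type) (A : K -> H) (B : H -> K) (S : I -> K -> K) (T : I -> H -> H).
Hypotheses (bA : bounded_op ipK ip A) (bB : bounded_op ip ipK B).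
Hypothesis Slin : forall i, linmap (S i).
Hypothesis Scontr : forall i x, hnorm ipK (S i x) <= hnorm ipK x.
Hypothesis TE : forall i x, T i x = A (S i (B x)).
Hypothesis comp : forall i j, exists m, (forall x, S m x = S i (S j x)) /\
  (forall x, T m x = T i (T j x)).

(* On the closed [S]-invariant subspace [L] of those [x] with [A (S i x) = T i (A x)], [A]
   intertwines [S] and [T], so the quotient norm [inf {|e| : e in L, A e = h}] makes every
   [T i] contractive; [E h] is the vector attaining that infimum. *)
Lemma unital_compression_similar : (forall x, A (B x) = x) ->
  jointly_similar_to_contractions ip T.
Proof.
move=> AB.
have Alin : linmap A by case: bA. have Blin : linmap B by case: bB.
have bS i : bounded_op ipK ipK (S i) by split; [exact: Slin|exists (1 : R) => x; rewrite mul1r].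
have bT i : bounded_op ip ip (T i).
  have [l [M hM]] := bounded_op_comp bA (bounded_op_comp (bS i) bB).
  by split=> [a x y|]; [rewrite !TE l|exists M => x; rewrite TE].
pose L x := forall i, A (S i x) - T i (A x) = 0.
have hLi i : closed_subspace ipK (fun x => A (S i x) - T i (A x) = 0).
  apply: (closed_kernel hH (bounded_opB hH (bounded_op_comp bA (bS i)) _)).
  exact: bounded_op_comp (bT i) bA.
have hL : closed_subspace ipK L := closed_subspace_bigI hLi.
pose Nl x := L x /\ A x = 0.
have hN : closed_subspace ipK Nl.
  by apply: closed_subspaceI => //; exact: (closed_kernel hH).
have LB h : L (B h) by move=> i; rewrite AB TE subrr.
(* The minimiser over the fibre [A x = h] in [L] is its vector orthogonal to [Nl]; orthogonality
   shows that it depends linearly on [h]. *)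
pose D h e := [/\ L e, A e = h & forall n, Nl n -> ipK e n = 0].
have Dmin h e x : D h e -> L x -> A x = h -> hnorm ipK e <= hnorm ipK x.
  case=> Le Ae orth Lx Ax.
  have /orth o : Nl (x - e) by split; [exact: cs_sub hL Lx Le|
    rewrite (linmapB _ _ Alin) Ax Ae subrr].
  rewrite -(ler_pXn2r (n := 2)) ?nnegrE ?hnorm_ge0 //.
  have -> : x = e + (x - e) by zmod.
  rewrite (hnormD_sq hKs) /rip o mulr0 addr0 lerDl sqr_ge0 //.
have [M [M0 hM]] := bounded_op_bound bB.
have [||||E [Elin [EM hE]]] := @graph_op _ _ _ ip ipK hs hK D M.
- exact: ltW.
- move=> a x y x' y' [L1 A1 o1] [L2 A2 o2]; split; first exact: (cs_lin hL).
    by rewrite Alin A1 A2.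
  by move=> n hn; rewrite (si_lin hKs) o1 // o2 // mulr0 addr0.
- by move=> h e De; apply: le_trans (Dmin _ _ _ De (LB h) (AB h)) (hM h).
- move=> h; have [p [[Lp Ap] o]] := orthogonal_projection hK (B h) hN.
  exists (B h - p); split => //; first exact: cs_sub hL (LB h) Lp.
  by rewrite (linmapB _ _ Alin) AB Ap subr0.
have [a [a0 ha]] := bounded_op_bound bA.
have low x : a^-1 * hnorm ip x <= hnorm ipK (E x).
  have [_ AE _] := hE x; have := ha (E x).
  by rewrite AE -ler_pdivrMl.
have bE : bounded_op ip ipK E by split => //; exists M.
have a0' : 0 < a^-1 by rewrite invr_gt0.
have [Q [g [k [bQ bg Qg gQ [k0 Qk]]]]] := polar_decomposition hH hK bE a0' low.
exists Q, g; do 4!split => //; move=> i x.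
rewrite -{2}(gQ x) !Qk ler_wpM2l //; first exact: ltW.
(* [S i (E h)] lies in [L] above [T i h], hence competes with the minimiser [E (T i h)]. The law
   [comp] is what makes [L] invariant under [S i]. *)
move: (g x) => h; apply: le_trans (Scontr i (E h)).
have [Lh Ah _] := hE h.
have ASE : A (S i (E h)) = T i h by apply/eqP; rewrite -subr_eq0 -{2}Ah Lh.
apply: (Dmin (T i h)) => // j.
have [m [Sm Tm]] := comp j i.
by rewrite -Sm ASE -Tm -{2}Ah Lh.
Qed.

End Similarity.

(** When the family lacks the identity, nothing forces [A (B x) = x]. The defect [x - A (B x)] is
    recovered from the extra summand, which [S' i] annihilates, so the factorization of each [T i]
    is unchanged. *)
Lemma compression_similar (R : realType) (H K : lmodType R[i])
  (ip : H -> H -> R[i]) (ipK : K -> K -> R[i]) (I : Type)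
  (A : K -> H) (B : H -> K) (S : I -> K -> K) (T : I -> H -> H) :
  is_hilbert ip -> is_hilbert ipK ->
  bounded_op ipK ip A -> bounded_op ip ipK B -> (forall i, linmap (S i)) ->
  (forall i x, hnorm ipK (S i x) <= hnorm ipK x) ->
  (forall i x, T i x = A (S i (B x))) ->
  (forall i j, exists m, (forall x, S m x = S i (S j x)) /\ (forall x, T m x = T i (T j x))) ->
  jointly_similar_to_contractions ip T.
Proof.
move=> hH hK bA bB Slin Scontr TE comp.
have hs := hilbert_semi hH; have hKs := hilbert_semi hK.
have Alin : linmap A by case: bA. have Blin : linmap B by case: bB.
have [a [a0 ha]] := bounded_op_bound bA; have [b [b0 hb]] := bounded_op_bound bB.
(* Adding [H] as a direct summand makes the factorization unital. *)
pose A' (p : K * H) : H := A p.1 + (p.2 - A (B p.2)).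
pose B' (h : H) : K * H := (B h, h).
pose S' i (p : K * H) : K * H := (S i p.1, 0).
apply: (@unital_compression_similar _ _ _ ip (prod_ip ipK ip) hH (prod_hilbert hK hH)
  I A' B' S' T).
- split=> [c x y|]; first by rewrite /A' /= Blin !Alin scalerDr scalerBr; zmod.
  exists (a + (1 + a * b)) => x.
  have h1 := ler_hnormD hs (A x.1) (x.2 - A (B x.2)).
  have h2 := ler_hnormB hs x.2 (A (B x.2)).
  have h3 : hnorm ip (A x.1) <= a * hnorm (prod_ip ipK ip) x.
    by rewrite (le_trans (ha _)) // ler_wpM2l ?(ltW a0) // le_prod_hnorm1.
  have h4 := le_prod_hnorm2 hK hH x.
  have h5 : hnorm ip (A (B x.2)) <= a * (b * hnorm (prod_ip ipK ip) x).
    rewrite (le_trans (ha _)) // ler_wpM2l ?(ltW a0) // (le_trans (hb _)) //.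
    by rewrite ler_wpM2l // ltW.
  rewrite /A' !mulrDl mul1r; lra.
- split=> [c x y|]; first by rewrite /B' Blin.
  exists (b + 1) => x; rewrite (le_trans (prod_hnorm_le hK hH _)) //= mulrDl mul1r lerD //.
- by move=> i c x y; rewrite /S' /= Slin; congr (_, _); rewrite /= scaler0 addr0.
- move=> i x; apply: le_trans (prod_hnorm_le hK hH _) _ => /=.
  by rewrite (hnorm0 hs) addr0 (le_trans (Scontr _ _)) // le_prod_hnorm1.
- by move=> i x; rewrite /A' /= -TE (linmap0 Blin) (linmap0 Alin) subr0 addr0.
- move=> i j; have [m [Sm Tm]] := comp i j; exists m; split => // x.
  by rewrite /S' Sm.
- by move=> x; rewrite /A' /=; zmod.
Qed.

Section UniformBoundedness.
Variables (R : realType) (V W : lmodType R[i]).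
Variables (ipV : V -> V -> R[i]) (ipW : W -> W -> R[i]).
Hypotheses (hV : is_hilbert ipV) (hW : semi_inner ipW).
Let hVs := hilbert_semi hV.
Local Notation NV := (hnorm ipV).
Local Notation NW := (hnorm ipW).

(* Gliding hump: nested balls on which ever larger members of the family are attained. *)
Lemma uniform_boundedness (F : nat -> V -> W) :
  (forall n, bounded_op ipV ipW (F n)) ->
  (forall x, exists M, forall n, NW (F n x) <= M) ->
  exists M, forall n x, NW (F n x) <= M * NV x.
Proof.
move=> bF pw; apply: contrapT => unb.
have big M : exists n x, M * NV x < NW (F n x).
  apply: contrapT => h; apply: unb; exists M => n x; rewrite leNgt; apply/negP => hx.
  by apply: h; exists n, x.
have step (s : V * R * nat) : exists p : V * R, 0 < s.1.2 ->
    [/\ NV (p.1 - s.1.1) <= s.1.2, 0 < p.2, p.2 <= s.1.2 / 2 &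
     exists n, forall z, NV (z - p.1) <= 2 * p.2 -> s.2%:R <= NW (F n z)].
  case: s => [[x r] k] /=; have [r0|r0] := ltP 0 r; last by exists (0, 0).
  have [n [y hy]] := big ((k.+1%:R) / r).
  have Flin : linmap (F n) by case: (bF n).
  have y0 : 0 < NV y.
    rewrite lt_def hnorm_ge0 andbT; apply/eqP => y0; move: hy.
    by rewrite (hnorm_eq0 hV y0) (linmap0 Flin) !hnorm0 // mulr0 ltxx.
  pose w := (r / NV y)%:C%C *: y.
  have nw : NV w = r.
    by rewrite /w hnormZr // ger0_norm ?divr_ge0 ?hnorm_ge0 ?(ltW r0) // divfK ?gt_eqF.
  have Fw : k.+1%:R <= NW (F n w).
    rewrite /w (linmapZ _ _ Flin) hnormZr // ger0_norm ?divr_ge0 ?hnorm_ge0 ?(ltW r0) //.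
    rewrite mulrAC ler_pdivlMr // -ler_pdivrMl // mulrA (mulrC r^-1).
    exact: ltW.
  (* One of [x + w], [x - w] works, since [2 F n w] is the difference of the values of [F n]
     there. *)
  have [x' [dx Fx']] : exists x', NV (x' - x) <= r /\ k.+1%:R <= NW (F n x').
    have h : NW (F n w + F n w) <= NW (F n (x + w)) + NW (F n (x - w)).
      have -> : F n w + F n w = F n (x + w) - F n (x - w).
        by rewrite (linmapB _ _ Flin) (linmapD _ _ Flin); zmod.
      exact: ler_hnormB.
    have h2 : NW (F n w + F n w) = 2 * NW (F n w).
      have -> : F n w + F n w = (2%:R)%:C%C *: F n w.
        by rewrite rmorph_nat scaler_nat mulr2n.
      by rewrite hnormZr // normr_nat.
    have [l|l] := leP (k.+1%:R) (NW (F n (x + w))).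
      exists (x + w); split => //; have -> : x + w - x = w by zmod.
      by rewrite nw.
    exists (x - w); split; last by lra.
    have -> : x - w - x = - w by zmod.
    by rewrite hnorm_opp // nw.
  have [b [b0 hb]] := bounded_op_bound (bF n).
  (* The bound [1 / (2 b)] keeps [F n] within [1] of its value at [x'] on the ball of twice the
     radius; halving at each stage keeps all later centres in that doubled ball. *)
  exists (x', Num.min (r / 2) (2 * b)^-1); split => //=.
  - by rewrite lt_min divr_gt0 //= invr_gt0 mulr_gt0.
  - by rewrite ge_min lexx.
  - exists n => z dz.
    have h := ler_hnorm_dist hW (F n x') (F n z).
    rewrite -(linmapB _ _ Flin) in h.
    have h1 : NW (F n (x' - z)) <= 1.
      apply: le_trans (hb _) _; rewrite (hnormBC hVs).
      apply: le_trans (ler_wpM2l (ltW b0) dz) _.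
      rewrite mulrA (mulrC b) -ler_pdivlMl ?mulr_gt0 // mulr1.
      by rewrite ge_min lexx orbT.
    move: h; rewrite ler_norml => /andP[_ h]; rewrite -natr1 in Fx'; lra.
have [f hf] := choice step.
pose s := fix s n : V * R := if n is m.+1 then f (s m, m) else (0, 1).
have s0 n : 0 < (s n).2 by elim: n => [|n IH] //=; case: (hf (s n, n) IH).
have shalf n : (s n.+1).2 <= (s n).2 / 2 by case: (hf (s n, n) (s0 n)).
have sgeo n : (s n).2 <= 1 * (2^-1) ^+ n.
  elim: n => [|n IH]; first by rewrite expr0 mulr1.
  by rewrite exprS; have := shalf n; lra.
have stail n p : NV ((s (n + p)%N).1 - (s n).1) <= 2 * (s n).2 - 2 * (s (n + p)%N).2.
  elim: p => [|p IH]; first by rewrite addn0 !subrr hnorm0.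
  rewrite addnS; have := ler_hnorm_split hVs (s (n + p)%N).1 (s (n + p).+1).1 (s n).1.
  have [h _ _ _] := hf (s (n + p)%N, (n + p)%N) (s0 _); have := shalf (n + p)%N.
  move: h; rewrite /=; lra.
have [||x hx] := @cauchy_rate_cvg _ _ _ hV (fun n => (s n).1) (fun n => 2 * (s n).2).
- move=> e e0; have i0 : 0 <= 2^-1 :> R by rewrite invr_ge0.
  have i1 : 2^-1 < 1 :> R by rewrite invf_lt1 // ltr1n.
  have [n0 h0] := geometric_small 2 i0 i1 e0.
  exists n0 => n /h0; have := sgeo n; lra.
- move=> m n; case: (leqP n m) => [nm|/ltnW mn].
    by have := stail n (m - n)%N; rewrite subnKC //; have := s0 m; lra.
  by have := stail m (n - m)%N; rewrite subnKC // (hnormBC hVs); have := s0 n; lra.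
have [M hM] := pw x.
pose k := (Num.truncn `|M|).+1.
have [_ _ _ [n /(_ x) hn]] := hf (s k, k) (s0 k).
have : k%:R <= NW (F n x).
  by apply: hn; rewrite (hnormBC hVs); exact: (hx k.+1).
apply/negP; rewrite -ltNge (le_lt_trans (hM n)) // (le_lt_trans (ler_norm _)) //.
by rewrite truncnS_gt.
Qed.

End UniformBoundedness.

(** * Local boundedness of strongly continuous semigroups *)

Section SemigroupBound.
Variables (R : realType) (H : lmodType R[i]) (ip : H -> H -> R[i]).
Hypothesis hH : is_hilbert ip.
Variable T : R -> H -> H.
Hypothesis hT : c0_semigroup ip T.
Local Notation N := (hnorm ip).
Let hs := hilbert_semi hH.

(** Otherwise there are times [t n] tending to [0] with [T (t n)] of norm above [n.+1]; strong
    continuity at [0] bounds [T (t n) x] for each [x], against uniform boundedness. *)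
Lemma semigroup_bounded_near0 : exists d M : R, [/\ 0 < d, 0 < M &
  forall (t : R) x, 0 <= t -> t <= d -> N (T t x) <= M * N x].
Proof.
apply: contrapT => unb.
have bad n : exists t, [/\ 0 <= t, t <= n.+1%:R^-1 & exists x, n.+1%:R * N x < N (T t x)].
  apply: contrapT => h; apply: unb; exists n.+1%:R^-1, n.+1%:R.
  split; rewrite ?invr_gt0 ?ltr0n // => t x t0 td.
  by rewrite leNgt; apply/negP => hx; apply: h; exists t; split => //; exists x.
have [t ht] := choice bad.
have [|x|M hM] := @uniform_boundedness _ _ _ _ _ hH hs (fun n => T (t n)).
- by move=> n; apply: (sg_bounded hT); case: (ht n).
- have [d [d0 hd]] := sg_cont hT x ltr01.
  have [n0 h0] := harmonic_small 1 d0.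
  apply: (@eventually_bounded _ _ (N x + 1) n0) => n; first exact: hnorm_ge0.
  move=> nn; have [tn0 tn _] := ht n.
  have tnd : t n < d by rewrite (le_lt_trans tn) // -div1r h0.
  have := hd _ tn0 tnd; have := ler_hnormD hs (T (t n) x - x) x; rewrite subrK; lra.
- have [_ _ [x]] := ht (Num.truncn `|M|); apply/negP; rewrite -leNgt.
  apply: le_trans (hM _ x) _; rewrite ler_wpM2r ?hnorm_ge0 //.
  by rewrite (le_trans (ler_norm _)) // ltW // truncnS_gt.
Qed.

Lemma semigroup_locally_bounded (b : R) : exists M : R, 0 < M /\
  forall (t : R) x, 0 <= t -> t <= b -> N (T t x) <= M * N x.
Proof.
have [d [M [d0 M0 hM]]] := semigroup_bounded_near0.
have bnd n : exists M' : R, 0 < M' /\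
    forall (t : R) x, 0 <= t -> t <= n%:R * d -> N (T t x) <= M' * N x.
  elim: n => [|n [M' [M'0 hM']]].
    exists M; split => // t x t0; rewrite mul0r => td; apply: hM => //.
    by rewrite (le_trans td) // ltW.
  exists (M + M * M'); split; first by rewrite addr_gt0 ?mulr_gt0.
  move=> t x t0 tn; have [td|td] := leP t d.
    rewrite (le_trans (hM _ _ t0 td)) // ler_wpM2r ?hnorm_ge0 // lerDl.
    by rewrite mulr_ge0 // ltW.
  have -> : t = d + (t - d) by rewrite addrC subrK.
  have td0 : 0 <= t - d by rewrite subr_ge0 ltW.
  rewrite (sg_add hT) ?(ltW d0) //.
  rewrite (le_trans (hM _ _ (ltW d0) (lexx d))) // mulrDl -mulrA.
  apply: (@le_trans _ _ (M * (M' * N x))).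
    rewrite ler_wpM2l ?(ltW M0) // hM' //; move: tn; rewrite -natr1; lra.
  by rewrite lerDr mulr_ge0 ?hnorm_ge0 // ltW.
have [M' [M'0 h]] := bnd (Num.truncn (b / d)).+1.
exists M'; split => // t x t0 tb; apply: h => //.
by rewrite (le_trans tb) // -ler_pdivrMr // ltW // truncnS_gt.
Qed.

End SemigroupBound.

(** * An averaged form contracted by the semigroup *)

Section GeneralizedLimit.
Variable R : realType.
Implicit Types (u v : nat -> R) (z w : nat -> R[i]).

Definition bounded_seq u := exists M : R, forall n, `|u n| <= M.

(** A positive normalised functional that ignores finitely many terms. [L] is defined on all
    sequences, with its laws restricted to bounded ones, so that it can be written down before
    boundedness is proved. *)
Record generalized_limit (L : (nat -> R) -> R) : Prop := {
  gl_lin : forall a u v, bounded_seq u -> bounded_seq v ->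
    L (fun n => a * u n + v n) = a * L u + L v;
  gl_le : forall u v, bounded_seq u -> bounded_seq v ->
    (exists N, forall n, (N <= n)%N -> u n <= v n) -> L u <= L v;
  gl_cst : forall c, L (fun=> c) = c }.

Local Open Scope classical_set_scope.

(** The limit is the supremum of the levels below [u] on a set of [U]; for a level above it, the
    ultrafilter must contain the complementary set. *)
Lemma ultrafilter_limit (U : set_system nat) u : UltraFilter U -> bounded_seq u ->
  exists l, forall e, 0 < e -> U [set n | `|u n - l| < e].
Proof.
move=> UU [M hM]; have PU : ProperFilter U by exact: ultra_proper.
pose S := [set r : R | U [set n | r <= u n]].
have hS : has_sup S.
  split.
    exists (- M); apply: filterS filterT => n _ /=.
    by have := hM n; rewrite ler_norml => /andP[].
  exists M => r /filter_ex [n /= hn]; apply: le_trans hn _.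
  by rewrite (le_trans (ler_norm _)).
exists (sup S) => e e0.
have [r Sr hr] := sup_adherent e0 hS.
have hi : U (~` [set n | sup S + e <= u n]).
  have [h|//] := in_ultra_setVsetC [set n | sup S + e <= u n] UU.
  have := @sup_ubound _ S hS.2 _ h; lra.
apply: filterS (filterI Sr hi) => n [/= h1 /negP]; rewrite -ltNge => h2.
by rewrite ltr_norml; apply/andP; split; lra.
Qed.

Lemma generalized_limit_exists : exists L, generalized_limit L.
Proof.
have [U [UU sub]] := ultraFilterLemma eventually_filter.
have PU : ProperFilter U by exact: ultra_proper.
have lim u : exists l, bounded_seq u -> forall e, 0 < e -> U [set n | `|u n - l| < e].
  have [/(ultrafilter_limit UU) [l hl]|nb] := pselect (bounded_seq u); first by exists l.
  by exists 0.
have [L hL] := choice lim; exists L; split.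
- move=> a u v bu bv.
  have buv : bounded_seq (fun n => a * u n + v n).
    case: bu bv => [M hM] [M' hM']; exists (`|a| * M + M') => n.
    by rewrite (le_trans (ler_normD _ _)) // lerD // normrM ler_wpM2l.
  apply/eqP; rewrite -subr_eq0 -normr_le0; apply/ler_addgt0Pr => e e0; rewrite add0r.
  pose k := `|a| + 2; have k0 : 0 < k by rewrite ltr_wpDl.
  have ek : 0 < e / k by rewrite divr_gt0.
  have [n [/= h1 [h2 h3]]] := filter_ex
    (filterI (hL _ buv _ ek) (filterI (hL _ bu _ ek) (hL _ bv _ ek))).
  have -> : L (fun n => a * u n + v n) - (a * L u + L v) =
    (a * (u n - L u) + (v n - L v)) - (a * u n + v n - L (fun n => a * u n + v n)) by ring.
  have eE : e = `|a| * (e / k) + e / k + e / k by rewrite /k; field; rewrite gt_eqF.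
  rewrite (le_trans (ler_normB _ _)) // eE lerD ?(ltW h1) //.
  rewrite (le_trans (ler_normD _ _)) // lerD ?(ltW h3) // normrM ler_wpM2l //.
  exact: ltW.
- move=> u v bu bv [N hN]; apply/ler_addgt0Pr => e e0.
  have e2 : 0 < e / 2 by rewrite divr_gt0.
  have evN : U [set n | (N <= n)%N] by apply: sub; exists N.
  have [n [/= h1 [h2 h3]]] := filter_ex
    (filterI evN (filterI (hL _ bu _ e2) (hL _ bv _ e2))).
  have := hN n h1; move: h2 h3; rewrite !ltr_norml => /andP[? ?] /andP[? ?]; lra.
- move=> c; have bc : bounded_seq (fun=> c) by exists `|c|.
  apply/eqP; rewrite -subr_eq0 -normr_le0; apply/ler_addgt0Pr => e e0; rewrite add0r.
  by have [n /= h] := filter_ex (hL _ bc _ e0); rewrite distrC ltW.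
Qed.

Variable L : (nat -> R) -> R.
Hypothesis hL : generalized_limit L.

Lemma gl_eq u v : bounded_seq u -> bounded_seq v ->
  (forall e, 0 < e -> exists N, forall n, (N <= n)%N -> `|u n - v n| <= e) -> L u = L v.
Proof.
move=> bu bv h.
have half u' v' : bounded_seq u' -> bounded_seq v' ->
  (forall e, 0 < e -> exists N, forall n, (N <= n)%N -> `|u' n - v' n| <= e) -> L u' <= L v'.
  move=> bu' bv' h'; apply/ler_addgt0Pr => e e0.
  have [N hN] := h' _ e0.
  have bc : bounded_seq (fun=> e) by exists `|e|.
  have -> : L v' + e = L (fun n => 1 * v' n + e) by rewrite (gl_lin hL) // (gl_cst hL) mul1r.
  apply: (gl_le hL) => //.
    case: bv' => M hM; exists (M + `|e|) => n.
    by rewrite mul1r (le_trans (ler_normD _ _)) // lerD.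
  exists N => n /hN; rewrite ler_norml => /andP[? ?]; lra.
apply/eqP; rewrite eq_le half //= half // => e /h[N hN].
by exists N => n; rewrite distrC; exact: hN.
Qed.

Lemma gl_ge0 u : bounded_seq u -> (forall n, 0 <= u n) -> 0 <= L u.
Proof.
move=> bu hu; rewrite -{1}(gl_cst hL 0); apply: (gl_le hL) => //; last by exists 0%N.
by exists 0 => n; rewrite normr0.
Qed.

Definition bounded_cseq z :=
  bounded_seq (fun n => complex.Re (z n)) /\ bounded_seq (fun n => complex.Im (z n)).

Definition clim z : R[i] :=
  Complex (L (fun n => complex.Re (z n))) (L (fun n => complex.Im (z n))).

Lemma bounded_seq_lin a u v : bounded_seq u -> bounded_seq v ->
  bounded_seq (fun n => a * u n + v n).
Proof.
case=> [M hM] [M' hM']; exists (`|a| * M + M') => n.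
by rewrite (le_trans (ler_normD _ _)) // lerD // normrM ler_wpM2l.
Qed.

Lemma clim_lin a z w : bounded_cseq z -> bounded_cseq w ->
  clim (fun n => a * z n + w n) = a * clim z + clim w.
Proof.
case=> [z1 z2] [w1 w2]; apply/eqP; rewrite eq_complex /=.
case: a => a b; apply/andP; split; apply/eqP.
  rewrite (_ : (fun n => _) = (fun n => a * complex.Re (z n) +
    ((- b) * complex.Im (z n) + complex.Re (w n)))); last first.
    by apply/funext => n; case: (z n) (w n) => [? ?] [? ?] /=; ring.
  rewrite (gl_lin hL) //; last exact: bounded_seq_lin.
  rewrite (gl_lin hL) //=; ring.
rewrite (_ : (fun n => _) = (fun n => a * complex.Im (z n) +
  (b * complex.Re (z n) + complex.Im (w n)))); last first.
  by apply/funext => n; case: (z n) (w n) => [? ?] [? ?] /=; ring.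
rewrite (gl_lin hL) //; last exact: bounded_seq_lin.
rewrite (gl_lin hL) //=; ring.
Qed.

Lemma clim_conj z : bounded_cseq z -> clim (fun n => conjc (z n)) = conjc (clim z).
Proof.
case=> [z1 z2]; apply/eqP; rewrite eq_complex /=; apply/andP; split; apply/eqP.
  by congr L; apply/funext => n; case: (z n).
have b0 : bounded_seq (fun=> 0) by exists 0 => n; rewrite normr0.
have -> : (fun n => complex.Im (conjc (z n))) = (fun n => (-1) * complex.Im (z n) + 0).
  by apply/funext => n; case: (z n) => [? ?] /=; ring.
by rewrite (gl_lin hL) // (gl_cst hL); ring.
Qed.

Lemma clim_cst (c : R[i]) : clim (fun=> c) = c.
Proof. by rewrite /clim !(gl_cst hL); case: c. Qed.

Lemma clim_eq z w : bounded_cseq z -> bounded_cseq w ->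
  (forall e, 0 < e -> exists N, forall n, (N <= n)%N ->
     `|complex.Re (z n) - complex.Re (w n)| <= e /\
     `|complex.Im (z n) - complex.Im (w n)| <= e) -> clim z = clim w.
Proof.
case=> [z1 z2] [w1 w2] h; congr Complex; apply: gl_eq => // e /h [N hN];
  by exists N => n /hN [].
Qed.

Section LimitForm.
Variables (V : lmodType R[i]) (F : nat -> V -> V -> R[i]).
Hypothesis hF : forall n, semi_inner (F n).
Hypothesis bF : forall x, exists M, forall n, hnorm (F n) x <= M.

Definition limit_form x y : R[i] := clim (fun n => F n x y).

Lemma bounded_form_seq x y : bounded_cseq (fun n => F n x y).
Proof.
have [M hM] := bF x; have [M' hM'] := bF y.
have h n : hnorm (F n) x * hnorm (F n) y <= M * M' by rewrite ler_pM ?hnorm_ge0.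
split; exists (M * M') => n; apply: le_trans (h n); [exact: rip_abs|exact: Im_ip_abs].
Qed.

Lemma limit_form_semi : semi_inner limit_form.
Proof.
split=> [a x y z|x y|x].
- rewrite /limit_form -clim_lin; try exact: bounded_form_seq.
  by congr clim; apply/funext => n; rewrite (si_lin (hF n)).
- rewrite /limit_form -clim_conj; last exact: bounded_form_seq.
  by congr clim; apply/funext => n; rewrite (si_conj (hF n)).
- by apply: gl_ge0; [case: (bounded_form_seq x x)|move=> n; exact: (si_pos (hF n))].
Qed.

Lemma limit_form_sq x : hnorm limit_form x ^+ 2 = L (fun n => hnorm (F n) x ^+ 2).
Proof.
rewrite (hnorm_sq limit_form_semi); congr L; apply/funext => n.
by rewrite (hnorm_sq (hF n)).
Qed.

Lemma bounded_sq_seq x : bounded_seq (fun n => hnorm (F n) x ^+ 2).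
Proof.
have [M hM] := bF x; exists (M ^+ 2) => n.
rewrite ger0_norm ?sqr_ge0 // lerXn2r ?nnegrE ?hnorm_ge0 //.
exact: le_trans (hnorm_ge0 _ _) (hM n).
Qed.

End LimitForm.

End GeneralizedLimit.

(** A shift by one trades [a 0] for [a N], which is no larger. *)
Lemma sum_shift_le (R : realType) (a : nat -> R) (N m : nat) :
  (forall i, a (i + N)%N <= a i) -> \sum_(i < N) a (i + m)%N <= \sum_(i < N) a i.
Proof.
elim: m a => [|m IH] a ha; first by under eq_bigr do rewrite addn0.
apply: (@le_trans _ _ (\sum_(i < N) a i.+1)).
  have := IH (fun i => a i.+1); under eq_bigr do rewrite -addnS.
  by apply => i; rewrite -addSn ha.
case: N ha {IH} => [|N] ha; first by rewrite !big_ord0.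
rewrite big_ord_recr [leRHS]big_ord_recl /= addrC lerD //.
by have := ha 0%N; rewrite add0n.
Qed.

Section ContractiveForm.
Variables (R : realType) (H : lmodType R[i]) (ip : H -> H -> R[i]).
Hypothesis hH : is_hilbert ip.
Variable T : R -> H -> H.
Hypothesis hT : c0_semigroup ip T.
Local Notation N := (hnorm ip).
Let hs := hilbert_semi hH.
Variables (tau : R) (Q g : H -> H).
Hypotheses (tau0 : 0 < tau) (bQ : bounded_op ip ip Q) (bg : bounded_op ip ip g).
Hypothesis Qg : cancel Q g.
Hypothesis contr : forall x, N (Q (T tau (g x))) <= N x.

Let s n i : R := i%:R * (tau / n.+1%:R).
(** Left endpoint sums over one period, in the norm [N (Q _)] for which [T tau] is a contraction.
    The mesh satisfies [s n (i + n.+1) = tau + s n i]. *)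
Let F n (x y : H) : R[i] :=
  (n.+1%:R^-1 : R)%:C%C * \sum_(i < n.+1) ip (Q (T (s n i) x)) (Q (T (s n i) y)).

Let s_ge0 n i : 0 <= s n i.
Proof. by rewrite mulr_ge0 ?ler0n // divr_ge0 ?ler0n // ltW. Qed.

Let s_le n i : (i <= n.+1)%N -> s n i <= tau.
Proof.
move=> ni; rewrite /s mulrA ler_pdivrMr ?ltr0n // mulrC ler_wpM2l ?(ltW tau0) //.
by rewrite ler_nat.
Qed.

Let Tlin t : 0 <= t -> linmap (T t).
Proof. by move=> /(sg_bounded hT) []. Qed.

Let Qlin : linmap Q. Proof. by case: bQ. Qed.

Let F_sq n x : complex.Re (F n x x) = n.+1%:R^-1 * \sum_(i < n.+1) N (Q (T (s n i) x)) ^+ 2.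
Proof.
rewrite /F.
have reM (a : R) c : complex.Re (a%:C%C * c) = a * complex.Re c by case: c => ? ? /=; ring.
rewrite reM; congr (_ * _).
have -> : \sum_(i < n.+1) N (Q (T (s n i) x)) ^+ 2 =
    \sum_(i < n.+1) complex.Re (ip (Q (T (s n i) x)) (Q (T (s n i) x))).
  by apply: eq_bigr => i _; rewrite hnorm_sq.
by rewrite raddf_sum.
Qed.

Let F_semi n : semi_inner (F n).
Proof.
split=> [a x y z|x y|x].
- rewrite /F mulrCA -mulrDr; congr (_ * _); rewrite mulr_sumr -big_split /=.
  by apply: eq_bigr => i _; rewrite Tlin // Qlin (si_lin hs).
- rewrite /F rmorphM rmorph_sum; congr (_ * _); first exact/esym/conjc_real.
  by apply: eq_bigr => i _; rewrite (si_conj hs).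
- rewrite F_sq mulr_ge0 ?invr_ge0 ?ler0n // sumr_ge0 // => i _; exact: sqr_ge0.
Qed.

Let F_norm n x : hnorm (F n) x ^+ 2 = n.+1%:R^-1 * \sum_(i < n.+1) N (Q (T (s n i) x)) ^+ 2.
Proof. by rewrite (hnorm_sq (F_semi n)) /rip F_sq. Qed.

Let F_bound : exists C, 0 < C /\ forall n x, hnorm (F n) x <= C * N x.
Proof.
have [M [M0 hM]] := semigroup_locally_bounded hH hT tau.
have [q [q0 hq]] := bounded_op_bound bQ.
exists (q * M); split; first exact: mulr_gt0.
move=> n x; have qM0 : 0 <= q * M * N x by rewrite !mulr_ge0 ?hnorm_ge0 // ltW.
rewrite -(ler_pXn2r (n := 2)) ?nnegrE ?hnorm_ge0 //.
rewrite F_norm mulrC ler_pdivrMr ?ltr0n //.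
apply: (@le_trans _ _ (\sum_(i < n.+1) (q * M * N x) ^+ 2)).
  apply: ler_sum => i _; rewrite lerXn2r ?nnegrE ?hnorm_ge0 //.
  rewrite (le_trans (hq _)) // -mulrA ler_wpM2l ?(ltW q0) //.
  by apply: hM => //; apply: s_le; exact: ltnW.
by rewrite sumr_const card_ord mulr_natr.
Qed.

(** Mesh times add through their indices, so the translation is an index shift, and a full period
    contracts by [contr]. *)
Let F_shift n m x : hnorm (F n) (T (s n m) x) ^+ 2 <= hnorm (F n) x ^+ 2.
Proof.
rewrite !F_norm ler_wpM2l ?invr_ge0 ?ler0n //.
have -> : \sum_(i < n.+1) N (Q (T (s n i) (T (s n m) x))) ^+ 2 =
    \sum_(i < n.+1) N (Q (T (s n (i + m)%N) x)) ^+ 2.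
  by apply: eq_bigr => i _; rewrite -(sg_add hT) // /s -mulrDl -natrD.
apply: (sum_shift_le (a := fun i => N (Q (T (s n i) x)) ^+ 2)) => i.
rewrite lerXn2r ?nnegrE ?hnorm_ge0 //.
have -> : s n (i + n.+1)%N = tau + s n i.
  by rewrite /s natrD mulrDl addrC mulrC divfK // pnatr_eq0.
rewrite (sg_add hT) ?(ltW tau0) // -{1}(Qg (T (s n i) x)); exact: contr.
Qed.

Let F_contr t x e : 0 <= t -> 0 < e -> exists n0, forall n, (n0 <= n)%N ->
  hnorm (F n) (T t x) ^+ 2 <= hnorm (F n) x ^+ 2 + e.
Proof.
move=> t0 e0; have [C [C0 hC]] := F_bound.
have [M [M0 hM]] := semigroup_locally_bounded hH hT (t + tau).
(* Chosen so that the error below, [C M (e / c)] times a sum of two norms at most [C M N x] each,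
   stays under [e]; the [+ 1] keeps [c] positive. *)
pose c := C * M * (C * (M * N x) + C * (M * N x)) + 1.
have c0 : 0 < c.
  by rewrite ltr_wpDl // !mulr_ge0 ?addr_ge0 ?mulr_ge0 ?hnorm_ge0 // ltW.
have [d [d0 hd]] := sg_cont hT x (divr_gt0 e0 c0).
have [n0 hn0] := harmonic_small tau d0.
exists n0 => n /hn0 hn.
have w0 : 0 < tau / n.+1%:R by rewrite divr_gt0 ?ltr0n.
have q0 : 0 <= t / (tau / n.+1%:R) by rewrite divr_ge0 // ltW.
(* The time is rounded up: [s n m - t] must be nonnegative for
   [T (s n m) x = T t (T (s n m - t) x)]. *)
pose m := (Num.truncn (t / (tau / n.+1%:R))).+1.
have lo : t < s n m by rewrite /s -ltr_pdivrMr // truncnS_gt.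
have hi : s n m <= t + tau / n.+1%:R.
  rewrite /s /m -natr1 mulrDl mul1r lerD2r -ler_pdivlMr //.
  by have /andP[] := truncn_itv q0.
have wtau : tau / n.+1%:R <= tau by rewrite ler_pdivrMr ?ltr0n // ler_peMr ?(ltW tau0) // ler1n.
have td0 : 0 <= s n m - t by rewrite subr_ge0 ltW.
have dist : N (T (s n m) x - T t x) <= M * (e / c).
  have -> : T (s n m) x = T t (T (s n m - t) x) by rewrite -(sg_add hT) // addrC subrK.
  rewrite -(linmapB _ _ (Tlin t0)).
  apply: le_trans (hM _ _ t0 _) _; first by rewrite lerDl ltW.
  by rewrite ler_wpM2l ?(ltW M0) // ltW // hd // ltrBlDl (le_lt_trans hi) // ltrD2l.
have := ler_hnorm_sqB (F_semi n) (T (s n m) x) (T t x).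
have h1 := F_shift n m x.
have b1 : hnorm (F n) (T (s n m) x) <= C * (M * N x).
  by rewrite (le_trans (hC _ _)) // ler_wpM2l ?(ltW C0) // hM ?s_ge0 // (le_trans hi) // lerD2l //.
have b2 : hnorm (F n) (T t x) <= C * (M * N x).
  by rewrite (le_trans (hC _ _)) // ler_wpM2l ?(ltW C0) // hM // lerDl ltW.
have b3 : hnorm (F n) (T (s n m) x - T t x) <= C * (M * (e / c)).
  exact: le_trans (hC _ _) (ler_wpM2l (ltW C0) dist).
have h2 : hnorm (F n) (T (s n m) x - T t x) *
    (hnorm (F n) (T (s n m) x) + hnorm (F n) (T t x)) <=
    C * (M * (e / c)) * (C * (M * N x) + C * (M * N x)).
  by apply: ler_pM; [exact: hnorm_ge0|by rewrite addr_ge0 ?hnorm_ge0|exact: b3|exact: lerD b1 b2].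
have h3 : C * (M * (e / c)) * (C * (M * N x) + C * (M * N x)) <= e.
  have -> : C * (M * (e / c)) * (C * (M * N x) + C * (M * N x)) =
      C * M * (C * (M * N x) + C * (M * N x)) / c * e by ring.
  by rewrite ler_piMl ?(ltW e0) // ler_pdivrMr // mul1r /c lerDl.
by move=> h4; apply: le_trans h4 _; apply: lerD h1 (le_trans h2 h3).
Qed.

Variable b : R.
Hypotheses (b0 : 0 < b) (btau : b < tau).

(** For a mesh time [s <= b], [T b x = T (b - s) (g (Q (T s x)))], so [N (T b x)] is at most [M q]
    times [N (Q (T s x))]. Such times make up at least the fraction [b / tau] of the mesh, whence
    the factor [tau / b]. *)
Let F_lower : exists C, 0 < C /\ forall n x, N (T b x) ^+ 2 <= C * hnorm (F n) x ^+ 2.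
Proof.
have [M [M0 hM]] := semigroup_locally_bounded hH hT b.
have [q [q0 hq]] := bounded_op_bound bg.
pose C := (M * q) ^+ 2 * (tau / b).
have Mq0 : 0 < (M * q) ^+ 2 by rewrite exprn_gt0 ?mulr_gt0.
exists C; split; first by rewrite mulr_gt0 ?divr_gt0.
move=> n x; rewrite F_norm.
pose y := b / (tau / n.+1%:R).
have w0 : 0 < tau / n.+1%:R by rewrite divr_gt0 ?ltr0n.
have y0 : 0 <= y by rewrite divr_ge0 // ltW.
(* The number of mesh points in [[0, b]], time [0] included; it exceeds [y], and [b < tau] keeps it
   at most [n.+1]. *)
pose m := (Num.truncn y).+1.
have /andP[ylo yhi] := truncn_itv y0.
have mn : (m <= n.+1)%N.
  rewrite /m -(ltr_nat R) (le_lt_trans ylo) // /y ltr_pdivrMr // mulrC divfK ?pnatr_eq0 //.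
pose gg i := N (Q (T (s n i) x)) ^+ 2.
have low i : (i < m)%N -> N (T b x) ^+ 2 <= (M * q) ^+ 2 * gg i.
  move=> im; have sb : s n i <= b.
    rewrite /s -ler_pdivlMr // (le_trans _ ylo) // ler_nat //.
  rewrite /gg -exprMn lerXn2r ?nnegrE ?mulr_ge0 ?hnorm_ge0 ?(ltW M0) ?(ltW q0) //.
  have -> : T b x = T (b - s n i) (g (Q (T (s n i) x))).
    by rewrite Qg -(sg_add hT) ?subr_ge0 // subrK.
  apply: le_trans (hM _ _ _ _) _; rewrite ?subr_ge0 // ?gerBl //.
  by rewrite -mulrA ler_wpM2l // ltW.
have gg0 i : 0 <= gg i by exact: sqr_ge0.
have sumlow : m%:R * N (T b x) ^+ 2 <= (M * q) ^+ 2 * \sum_(i < n.+1) gg i.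
  have -> : m%:R * N (T b x) ^+ 2 = \sum_(i < m) N (T b x) ^+ 2.
    by rewrite sumr_const card_ord mulr_natl.
  rewrite (big_ord_widen _ (fun=> N (T b x) ^+ 2) mn) mulr_sumr big_mkcond /=.
  apply: ler_sum => i _; case: ifP => [/low //|_].
  by rewrite mulr_ge0 // ltW.
have yE : y = (b / tau) * n.+1%:R by rewrite /y invf_div mulrA mulrAC.
have hy : y * N (T b x) ^+ 2 <= (M * q) ^+ 2 * \sum_(i < n.+1) gg i.
  by apply: le_trans sumlow; rewrite ler_wpM2r ?sqr_ge0 // ltW.
have yp : 0 < y by rewrite divr_gt0.
rewrite -(ler_pM2l yp); apply: le_trans hy _.
rewrite yE /C le_eqVlt; apply/orP; left; apply/eqP.
have n1 : 0 < n.+1%:R :> R by rewrite ltr0n.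
move: (\sum_(i < n.+1) _) => S1; move: n.+1%:R n1 => w wp; field.
by rewrite !gt_eqF.
Qed.

(* The form is a generalized limit of averages of [<Q T(s) x, Q T(s) y>] over [0, tau]: in the
   limit it is invariant under translation except for the boundary term, which has the right
   sign because [Q T(tau) Q^-1] is a contraction. *)
Lemma contractive_form : exists f : H -> H -> R[i], [/\ semi_inner f,
  exists C, forall x, hnorm f x <= C * N x,
  forall (t : R) x, 0 <= t -> hnorm f (T t x) <= hnorm f x &
  exists C, 0 <= C /\ forall x, N (T b x) <= C * hnorm f x].
Proof.
have [L hL] := generalized_limit_exists R.
have [C [C0 hC]] := F_bound; have [D [D0 hD]] := F_lower.
have bF x : exists M, forall n, hnorm (F n) x <= M by exists (C * N x).
have hf := limit_form_semi hL F_semi bF.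
have fsq := limit_form_sq hL F_semi bF.
have bsq x := bounded_sq_seq bF x.
have bc c : bounded_seq (fun=> c : R) by exists `|c|.
exists (limit_form L F); split => //.
- exists C => x; have CN0 : 0 <= C * N x by rewrite mulr_ge0 ?hnorm_ge0 // ltW.
  rewrite -(ler_pXn2r (n := 2)) ?nnegrE ?hnorm_ge0 // fsq -[leRHS](gl_cst hL).
  apply: (gl_le hL) => //; exists 0%N => n _.
  by rewrite lerXn2r ?nnegrE ?hnorm_ge0.
- move=> t x t0; rewrite -(ler_pXn2r (n := 2)) ?nnegrE ?hnorm_ge0 // !fsq.
  apply/ler_addgt0Pr => e e0; have [n0 h] := F_contr x t0 e0.
  have -> : L (fun n => hnorm (F n) x ^+ 2) + e =
      L (fun n => 1 * hnorm (F n) x ^+ 2 + e) by rewrite (gl_lin hL) // (gl_cst hL) mul1r.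
  apply: (gl_le hL) => //; first exact: bounded_seq_lin.
  by exists n0 => n /h; rewrite mul1r.
- exists (Num.sqrt D); split; first exact: sqrtr_ge0.
  move=> x; rewrite -(ler_pXn2r (n := 2)) ?nnegrE ?mulr_ge0 ?sqrtr_ge0 ?hnorm_ge0 //.
  rewrite exprMn (sqr_sqrtr (ltW D0)) fsq.
  have -> : D * L (fun n => hnorm (F n) x ^+ 2) = L (fun n => D * hnorm (F n) x ^+ 2 + 0).
    by rewrite (gl_lin hL) // (gl_cst hL) addr0.
  rewrite -[leLHS](gl_cst hL); apply: (gl_le hL) => //; first exact: bounded_seq_lin.
  by exists 0%N => n _; rewrite addr0.
Qed.

End ContractiveForm.

(** * Completions and Hilbert spaces of kernels *)

Section FunctionSubspace.
Variables (C : comNzRingType) (Y : Type).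

(** Both spaces constructed below consist of scalar functions with pointwise operations, so that
    equality is extensional and no quotient has to be formed. *)
Record fun_subspace (P : (Y -> C) -> Prop) : Prop := {
  fs0 : P (fun=> 0);
  fs_lin : forall a f g, P f -> P g -> P (fun y => a * f y + g y) }.

Variables (P : (Y -> C) -> Prop) (hP : fun_subspace P).

(* [hP] occurs in the type so that the module structure below can be inferred from it. *)
Definition subfun (_ : fun_subspace P) := {f : Y -> C | P f}.
Local Notation K := (subfun hP).

HB.instance Definition _ := gen_eqMixin K.
HB.instance Definition _ := gen_choiceMixin K.

Lemma subfun_ext (f g : K) : sval f =1 sval g -> f = g.
Proof. by case: f g => [f Pf] [g Pg] /= /funext fg; apply: eq_exist. Qed.

Let comb a (f g : K) : K := exist P _ (fs_lin hP a (svalP f) (svalP g)).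
Let zero : K := exist P _ (fs0 hP).
Let addA : associative (comb 1).
Proof. by move=> f g h; apply: subfun_ext => y /=; rewrite !mul1r addrA. Qed.
Let addC : commutative (comb 1).
Proof. by move=> f g; apply: subfun_ext => y /=; rewrite !mul1r addrC. Qed.
Let add0 : left_id zero (comb 1).
Proof. by move=> f; apply: subfun_ext => y /=; rewrite !mul1r add0r. Qed.
Let addN : left_inverse zero (fun f => comb (-1) f zero) (comb 1).
Proof. by move=> f; apply: subfun_ext => y /=; rewrite mul1r addr0 mulN1r addNr. Qed.

HB.instance Definition _ := GRing.isZmodule.Build K addA addC add0 addN.

Let scale (a : C) (f : K) : K := comb a f zero.
Let scaleA a b f : scale a (scale b f) = scale (a * b) f.
Proof. by apply: subfun_ext => y /=; rewrite !addr0 mulrA. Qed.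
Let scale1 : left_id 1 scale.
Proof. by move=> f; apply: subfun_ext => y /=; rewrite mul1r addr0. Qed.
Let scaleDr : right_distributive scale +%R.
Proof.
by move=> a f g; apply: subfun_ext => y /=; rewrite !addr0 !mul1r mulrDr.
Qed.
Let scaleDl f : {morph scale^~ f : a b / a + b}.
Proof. by move=> a b; apply: subfun_ext => y /=; rewrite !addr0 mul1r mulrDl. Qed.

HB.instance Definition _ := GRing.Zmodule_isLmodule.Build C K scaleA scale1 scaleDr scaleDl.

Lemma subfun_linE a (f g : K) y : sval (a *: f + g) y = a * sval f y + sval g y.
Proof. by rewrite /= addr0 mul1r. Qed.

Lemma subfun0E y : sval (0 : K) y = 0. Proof. by []. Qed.

End FunctionSubspace.

Section Completion.
Variables (R : realType) (X : lmodType R[i]) (F : X -> X -> R[i]).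
Hypothesis hF : semi_inner F.
Variable L : (nat -> R) -> R.
Hypothesis hL : generalized_limit L.
Local Notation N := (hnorm F).

Let cauchy (u : nat -> X) := forall e : R, 0 < e -> exists n0, forall m n,
  (n0 <= m)%N -> (n0 <= n)%N -> N (u m - u n) < e.

Let cauchy_bound u : cauchy u -> exists M, forall n, N (u n) <= M.
Proof.
move=> hu; have [n0 h0] := hu _ ltr01.
apply: (@eventually_bounded _ _ (N (u n0) + 1) n0) => n; first exact: hnorm_ge0.
move=> nn; have := h0 n n0 nn (leqnn n0); have := ler_hnormD hF (u n - u n0) (u n0).
by rewrite subrK; lra.
Qed.

Let cauchy_lin a u v : cauchy u -> cauchy v -> cauchy (fun n => a *: u n + v n).
Proof.
move=> hu hv e e0; have a0 := normc_ge0 a.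
pose k := normc a + 1; have k0 : 0 < k by rewrite ltr_wpDl.
have ek : 0 < e / k by rewrite divr_gt0.
have [n1 h1] := hu _ ek; have [n2 h2] := hv _ ek.
exists (maxn n1 n2) => m n; rewrite !geq_max => /andP[m1 m2] /andP[l1 l2].
have -> : a *: u m + v m - (a *: u n + v n) = a *: (u m - u n) + (v m - v n).
  by rewrite scalerBr; zmod.
rewrite (le_lt_trans (ler_hnormD hF _ _)) // (hnormZ hF).
have -> : e = normc a * (e / k) + e / k by rewrite /k; field; rewrite gt_eqF.
by rewrite ler_ltD ?h2 // ler_wpM2l // ltW // h1.
Qed.

Let cauchy_cst x : cauchy (fun=> x).
Proof. by move=> e e0; exists 0%N => m n _ _; rewrite subrr hnorm0. Qed.

Let form_bounded u v : cauchy u -> cauchy v -> bounded_cseq (fun n => F (u n) (v n)).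
Proof.
move=> /cauchy_bound[M hM] /cauchy_bound[M' hM'].
have h n : N (u n) * N (v n) <= M * M' by rewrite ler_pM ?hnorm_ge0.
split; exists (M * M') => n; apply: le_trans (h n); [exact: rip_abs|exact: Im_ip_abs].
Qed.

(** Cauchy sequences are identified through the function they induce on [X], instead of being
    divided by null sequences; [L] supplies the limit as a total operation. *)
Let rep (u : nat -> X) (f : X -> R[i]) :=
  cauchy u /\ f = fun y => clim L (fun n => F (u n) y).

Let rep_lin a u v f g : rep u f -> rep v g ->
  rep (fun n => a *: u n + v n) (fun y => a * f y + g y).
Proof.
case=> hu -> [hv ->]; split; first exact: cauchy_lin.
apply/funext => y; rewrite -(clim_lin hL).
- by congr clim; apply/funext => n; rewrite (si_lin hF).
- exact: form_bounded (cauchy_cst _).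
- exact: form_bounded (cauchy_cst _).
Qed.

Let limits : fun_subspace (fun f : X -> R[i] => exists u, rep u f).
Proof.
split=> [|a f g [u hu] [v hv]]; last by exists (fun n => a *: u n + v n); exact: rep_lin.
exists (fun=> 0); split; first exact: cauchy_cst.
by apply/funext => y; rewrite (clim_cst hL) (ip0l hF).
Qed.

Local Notation K := (subfun limits).

(** The difference [w = u - v] is Cauchy and [F (w m) (w n)] has limit [0] in [m], yet its real part
    is eventually at least [N (w n) ^+ 2 - e * N (w n)]; hence [N (w n) <= e]. This makes
    [completion_ip] independent of the chosen sequences. *)
Let null_diff u v f : rep u f -> rep v f ->
  forall e : R, 0 < e -> exists n0, forall n, (n0 <= n)%N -> N (u n - v n) <= e.
Proof.
move=> ru rv e e0.
pose w n := (-1) *: v n + u n.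
have [cw w0] : rep w (fun y => (-1) * f y + f y) by exact: rep_lin.
have [n0 h0] := cw _ e0; exists n0 => n hn.
have -> : u n - v n = w n by rewrite /w scaleN1r addrC.
have := congr1 (fun f => complex.Re (f (w n))) w0.
rewrite mulN1r addNr /= => lim0.
have [b1 _] := form_bounded cw (cauchy_cst (w n)).
pose c := N (w n) ^+ 2 - e * N (w n).
have : L (fun=> c) <= L (fun m => complex.Re (F (w m) (w n))).
  apply: (gl_le hL) => //; first by exists `|c|.
  exists n0 => m hm; rewrite /c (hnorm_sq hF) -/(rip F (w m) (w n)).
  have -> : rip F (w n) (w n) = rip F (w m) (w n) + rip F (w n - w m) (w n).
    by rewrite -(ripDl hF) addrC subrK.
  have := rip_le hF (w n - w m) (w n).
  have : N (w n - w m) * N (w n) <= e * N (w n).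
    by rewrite ler_wpM2r ?hnorm_ge0 // ltW // h0.
  lra.
rewrite (gl_cst hL) -lim0 /c expr2 -mulrBl.
have [z|z] := eqVneq (N (w n)) 0; first by move=> _; rewrite z ltW.
by rewrite pmulr_lle0 ?subr_le0 // lt_def z hnorm_ge0.
Qed.

Let cseq (f : K) : nat -> X := sval (cid (svalP f)).
Let cseqP (f : K) : rep (cseq f) (sval f).
Proof. exact: (svalP (cid (svalP f))). Qed.

Definition completion_ip (f g : K) : R[i] := clim L (fun n => F (cseq f n) (cseq g n)).
Local Notation ip := completion_ip.

Let ipE u v (f g : K) : rep u (sval f) -> rep v (sval g) ->
  ip f g = clim L (fun n => F (u n) (v n)).
Proof.
move=> ru rv; have rf := cseqP f; have rg := cseqP g.
apply: (clim_eq hL); try (apply: form_bounded; by [case: ru|case: rv|case: rf|case: rg]).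
move=> e e0.
have [M hM] := cauchy_bound rg.1; have [M' hM'] := cauchy_bound ru.1.
have M0 : 0 <= M := le_trans (hnorm_ge0 F _) (hM 0%N).
have M'0 : 0 <= M' := le_trans (hnorm_ge0 F _) (hM' 0%N).
pose k := M + M' + 1; have k0 : 0 < k by rewrite ltr_wpDl ?addr_ge0.
have ek : 0 < e / k by rewrite divr_gt0.
have [n1 h1] := null_diff rf ru ek; have [n2 h2] := null_diff rg rv ek.
exists (maxn n1 n2) => n; rewrite geq_max => /andP[/h1 {}h1 /h2 {}h2].
have small : N (cseq f n - u n) * N (cseq g n) + N (u n) * N (cseq g n - v n) <= e.
  have -> : e = e / k * M + M' * (e / k) + e / k by rewrite /k; field; rewrite gt_eqF.
  rewrite -[leLHS]addr0 lerD ?(ltW ek) // lerD //; apply: ler_pM => //; exact: hnorm_ge0.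
have E : F (cseq f n) (cseq g n) - F (u n) (v n) =
    F (cseq f n - u n) (cseq g n) + F (u n) (cseq g n - v n).
  by rewrite (ipBl hF) (ipBr hF); ring.
by rewrite -!raddfB E !raddfD; split; apply: le_trans small;
  rewrite (le_trans (ler_normD _ _)) // lerD //; solve [exact: rip_abs|exact: Im_ip_abs].
Qed.

Let ip_semi : semi_inner ip.
Proof.
split=> [a f g h|f g|f].
- have rfg : rep (fun n => a *: cseq f n + cseq g n) (sval (a *: f + g)).
    have -> : sval (a *: f + g) = fun y => a * sval f y + sval g y.
      by apply/funext => y; exact: subfun_linE.
    exact: rep_lin.
  rewrite (ipE rfg (cseqP h)) -(clim_lin hL).
  + by congr clim; apply/funext => n; rewrite (si_lin hF).
  + exact: form_bounded (cseqP f).1 (cseqP h).1.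
  + exact: form_bounded (cseqP g).1 (cseqP h).1.
- rewrite /ip -(clim_conj hL); last exact: form_bounded (cseqP f).1 (cseqP g).1.
  by congr clim; apply/funext => n; rewrite (si_conj hF).
- apply: (gl_ge0 hL); last by move=> n; exact: (si_pos hF).
  by case: (form_bounded (cseqP f).1 (cseqP f).1).
Qed.

Let J (x : X) : K.
Proof.
exists (fun y => F x y); exists (fun=> x); split; first exact: cauchy_cst.
by apply/funext => y; rewrite (clim_cst hL).
Defined.

Let repJ x : rep (fun=> x) (sval (J x)).
Proof.
by split; [exact: cauchy_cst|apply/funext => y; rewrite (clim_cst hL)].
Qed.

Let Jlin : linmap J.
Proof.
by move=> a x y; apply: subfun_ext => z; rewrite subfun_linE /= (si_lin hF).
Qed.

Let ipJ x y : ip (J x) (J y) = F x y.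
Proof. by rewrite (ipE (repJ x) (repJ y)) (clim_cst hL). Qed.

Let ip_eval f y : ip f (J y) = sval f y.
Proof. by have [c e] := cseqP f; rewrite (ipE (cseqP f) (repJ y)) [in RHS]e. Qed.

Let NK := hnorm ip.

Let dist_le u (f : K) x e : rep u (sval f) -> 0 <= e ->
  (exists n0, forall n, (n0 <= n)%N -> N (u n - x) <= e) -> NK (f - J x) <= e.
Proof.
move=> ru e0 [n0 h0].
have r : rep (fun n => (-1) *: x + u n) (sval (f - J x)).
  have -> : sval (f - J x) = fun y => (-1) * sval (J x) y + sval f y.
    by apply/funext => y; rewrite addrC -scaleN1r subfun_linE.
  exact: rep_lin.
rewrite /NK -(ler_pXn2r (n := 2)) ?nnegrE ?hnorm_ge0 // (hnorm_sq ip_semi) /rip (ipE r r) /=.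
have [b _] := form_bounded r.1 r.1.
rewrite -[leRHS](gl_cst hL); apply: (gl_le hL) => //; first by exists `|e ^+ 2|.
exists n0 => n /h0 h; have -> : (-1) *: x + u n = u n - x by rewrite scaleN1r addrC.
have -> : complex.Re (F (u n - x) (u n - x)) = N (u n - x) ^+ 2 by rewrite (hnorm_sq hF).
by rewrite lerXn2r ?nnegrE ?hnorm_ge0.
Qed.

Let dense (f : K) e : 0 < e -> exists x, NK (f - J x) <= e.
Proof.
move=> e0; have r := cseqP f; have [n0 h0] := r.1 _ e0.
exists (cseq f n0); apply: (dist_le r); first exact: ltW.
by exists n0 => n hn; rewrite ltW // h0.
Qed.

Let ip_hilbert : is_hilbert ip.
Proof.
split; [exact: si_lin ip_semi|exact: si_conj ip_semi| | |].
- by move=> f; split; [exact: si_pos ip_semi f|exact: ip_Im ip_semi f].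
(* Definiteness comes from the reproducing identity [ip_eval]: a null [f] pairs to zero with every
   [J y], so all its values vanish. *)
- move=> f f0; apply: subfun_ext => y; rewrite subfun0E -ip_eval.
  by apply: (hnorm_eq0_ip ip_semi); rewrite /hnorm f0 sqrtr0.
(* Completeness: replacing each [v n] by a nearby [J (x n)] gives a Cauchy sequence in [X], whose
   induced function is the limit. *)
- move=> v hv.
  have n0 n : 0 < n.+1%:R^-1 :> R by rewrite invr_gt0 ltr0n.
  have [x hx] := choice (fun n => dense (v n) (n0 n)).
  have NJ p q : NK (J p - J q) = N (p - q).
    by rewrite -(linmapB _ _ Jlin) /NK /hnorm ipJ.
  have near (e : R) : 0 < e -> exists n1, forall n, (n1 <= n)%N -> NK (v n - J (x n)) < e.
    move=> e0; have [n1 h1] := harmonic_small 1 e0.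
    by exists n1 => n /h1; rewrite div1r; exact: le_lt_trans.
  have cx : cauchy x.
    move=> e e0; have e3 : 0 < e / 3 by rewrite divr_gt0.
    have [n1 h1] := near _ e3; have [n2 h2] := hv _ e3.
    exists (maxn n1 n2) => m n; rewrite !geq_max => /andP[m1 m2] /andP[l1 l2].
    have b1 := h1 m m1; have b2 := h1 n l1; have b3 := h2 m n m2 l2.
    have := ler_hnorm_split ip_semi (v m) (J (x m)) (J (x n)).
    have := ler_hnorm_split ip_semi (v n) (v m) (J (x n)).
    rewrite (hnormBC ip_semi (J (x m)) (v m)) -NJ -/NK.
    move: b1 b2 b3; rewrite -/NK.
    move: (NK _) (NK _) (NK _) (NK _) (NK _) => a b c d d'; lra.
  pose f : K := exist _ (fun y => clim L (fun n => F (x n) y)) (ex_intro _ x (conj cx erefl)).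
  have rf : rep x (sval f) by [].
  exists f => e e0; have e3 : 0 < e / 3 by rewrite divr_gt0.
  have [n1 h1] := near _ e3; have [n2 h2] := cx _ e3.
  exists (maxn n1 n2) => n; rewrite !geq_max => /andP[l1 l2].
  have d : NK (f - J (x n)) <= e / 3.
    apply: (dist_le rf); first exact: ltW.
    by exists n2 => m hm; rewrite ltW // h2.
  have := ler_hnorm_split ip_semi (J (x n)) (v n) f; have := h1 n l1.
  move: d; rewrite /NK (hnormBC ip_semi f).
  move: (hnorm _ _) (hnorm _ _) (hnorm _ _) => a b c; lra.
Qed.

Lemma completion_of_limit : exists (K : lmodType R[i]) (ipK : K -> K -> R[i]) (j : X -> K),
  [/\ is_hilbert ipK, linmap j, forall x y, ipK (j x) (j y) = F x y &
   forall f e, 0 < e -> exists x, hnorm ipK (f - j x) <= e].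
Proof. by exists K, ip, J; split. Qed.

End Completion.

Lemma completion_exists (R : realType) (X : lmodType R[i]) (F : X -> X -> R[i]) :
  semi_inner F -> exists (K : lmodType R[i]) (ipK : K -> K -> R[i]) (j : X -> K),
  [/\ is_hilbert ipK, linmap j, forall x y, ipK (j x) (j y) = F x y &
   forall f e, 0 < e -> exists x, hnorm ipK (f - j x) <= e].
Proof.
by move=> hF; have [L hL] := generalized_limit_exists R; exact: (completion_of_limit hF hL).
Qed.

Section KernelSpace.
Variables (R : realType) (I : Type) (W : lmodType R[i]).
Variable k : I -> I -> W -> W -> R[i].
Hypothesis klin : forall i j a w w' v, k i j (a *: w + w') v = a * k i j w v + k i j w' v.
Hypothesis kherm : forall i j w v, k j i v w = conjc (k i j w v).
Hypothesis kpsd : forall l : seq (I * W),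
  0 <= complex.Re (\sum_(p <- l) \sum_(q <- l) k p.1 q.1 p.2 q.2).

Let ev (l : seq (I * W)) (q : I * W) : R[i] := \sum_(p <- l) k p.1 q.1 p.2 q.2.

Let k0 i j v : k i j 0 v = 0.
Proof. by have := klin i j (-1) 0 0 v; rewrite scaler0 addr0 mulN1r addNr. Qed.

Let kZ i j a w v : k i j (a *: w) v = a * k i j w v.
Proof. by rewrite -[a *: w]addr0 klin k0 addr0. Qed.

Let spanP : fun_subspace (fun f : I * W -> R[i] => exists l, f = ev l).
Proof.
split=> [|a f g [l ->] [l' ->]].
  by exists [::]; apply/funext => q; rewrite /ev big_nil.
exists ([seq (p.1, a *: p.2) | p <- l] ++ l'); apply/funext => q.
rewrite /ev big_cat big_map mulr_sumr /=; congr (_ + _).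
by apply: eq_bigr => p _; rewrite kZ.
Qed.

Local Notation X := (subfun spanP).

Let lst (f : X) : seq (I * W) := sval (cid (svalP f)).
Let lstE (f : X) : sval f = ev (lst f). Proof. exact: (svalP (cid (svalP f))). Qed.

Let form (f g : X) : R[i] := \sum_(q <- lst g) sval f q.

(** By hermitian symmetry the sum equals one involving [g] only through its values at the points of
    [lst f], so it does not depend on how [g] is written as a combination. *)
Let formE (f g : X) l : sval g = ev l -> form f g = \sum_(q <- l) sval f q.
Proof.
have E l' : \sum_(q <- l') sval f q = \sum_(p <- lst f) conjc (ev l' p).
  rewrite lstE /ev exchange_big /=; apply: eq_bigr => p _.
  by rewrite [RHS]rmorph_sum; apply: eq_bigr => q _; rewrite kherm.
by move=> gl; rewrite /form !E; apply: eq_bigr => p _; rewrite -lstE gl.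
Qed.

Let form_semi : semi_inner form.
Proof.
split=> [a f g h|f g|f].
- rewrite /form mulr_sumr -big_split /=; apply: eq_bigr => q _; exact: subfun_linE.
- rewrite /form [RHS]rmorph_sum /=.
  have -> : \sum_(q <- lst f) sval g q = \sum_(q <- lst f) ev (lst g) q by rewrite -lstE.
  rewrite /ev exchange_big /=; apply: eq_bigr => p _.
  by rewrite lstE /ev [RHS]rmorph_sum; apply: eq_bigr => q _; rewrite kherm.
- by rewrite /form lstE /ev exchange_big; exact: kpsd.
Qed.

Let elt (i : I) (w : W) : X.
Proof. by exists (ev [:: (i, w)]), [:: (i, w)]. Defined.

Let eltE i w q : sval (elt i w) q = k i q.1 w q.2.
Proof. by rewrite /= /ev big_seq1. Qed.

Let elt_lin i : linmap (elt i).
Proof.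
by move=> a w w'; apply: subfun_ext => q; rewrite subfun_linE !eltE klin.
Qed.

Let elt_sum l : forall q, sval (\sum_(p <- l) elt p.1 p.2) q = ev l q.
Proof.
elim: l => [|p l IH] q; first by rewrite big_nil subfun0E /ev big_nil.
by rewrite big_cons -[elt _ _]scale1r subfun_linE IH mul1r eltE /ev big_cons.
Qed.

(** The Moore-Aronszajn construction: the completed span of the sections of [k], with the
    reproducing form; positivity of the form is [kpsd]. *)
Lemma kernel_hilbert : exists (K : lmodType R[i]) (ipK : K -> K -> R[i]) (phi : I -> W -> K),
  [/\ is_hilbert ipK, forall i, linmap (phi i),
   forall i j w v, ipK (phi i w) (phi j v) = k i j w v &
   forall x e, 0 < e -> exists l : seq (I * W),
     hnorm ipK (x - \sum_(p <- l) phi p.1 p.2) <= e].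
Proof.
have [K [ipK [j [hK jlin jE jd]]]] := completion_exists form_semi.
exists K, ipK, (fun i w => j (elt i w)); split => //.
- by move=> i a w w'; rewrite elt_lin jlin.
- move=> i i' w v; rewrite jE (formE _ (l := [:: (i', v)])) //.
  by rewrite big_seq1 eltE.
- move=> x e e0; have [f hf] := jd x e e0; exists (lst f).
  have -> : \sum_(p <- lst f) j (elt p.1 p.2) = j f; last by [].
  have fE : f = \sum_(p <- lst f) elt p.1 p.2.
    by apply: subfun_ext => q; rewrite elt_sum -lstE.
  rewrite [RHS](congr1 j fE).
  elim: (lst _) => [|p l IH]; first by rewrite !big_nil (linmap0 jlin).
  by rewrite !big_cons (linmapD _ _ jlin) IH.
Qed.

End KernelSpace.

(** * Unitary dilation *)

Lemma isometry_ip (R : realType) (V W : lmodType R[i]) (ipV : V -> V -> R[i])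
    (ipW : W -> W -> R[i]) (f : V -> W) : semi_inner ipV -> semi_inner ipW -> linmap f ->
  (forall x, hnorm ipW (f x) = hnorm ipV x) -> forall x y, ipW (f x) (f y) = ipV x y.
Proof.
move=> hV hW flin fN.
have re x y : rip ipW (f x) (f y) = rip ipV x y.
  have := hnormD_sq hW (f x) (f y); have := hnormD_sq hV x y.
  rewrite -(linmapD _ _ flin) !fN; lra.
move=> x y; apply/eqP; rewrite eq_complex (Im_rip hW) (Im_rip hV) -(linmapZ _ _ flin).
by apply/andP; split; apply/eqP; exact: re.
Qed.

(* Douglas' factorization: [T1 = A B] with [A = 0] on the orthogonal complement of [B H]. *)
Lemma douglas_factorization (R : realType) (H K : lmodType R[i]) (ip : H -> H -> R[i])
    (ipK : K -> K -> R[i]) (B : H -> K) (T1 : H -> H) (C : R) :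
  is_hilbert ip -> is_hilbert ipK -> linmap B -> linmap T1 -> 0 <= C ->
  (forall h, hnorm ip (T1 h) <= C * hnorm ipK (B h)) ->
  exists A : K -> H, bounded_op ipK ip A /\
    forall h x, (forall h', ipK (x - B h) (B h') = 0) -> A x = T1 h.
Proof.
move=> hH hK Blin Tlin C0 hC.
have hs := hilbert_semi hH; have hKs := hilbert_semi hK.
pose D x y := exists h, (forall h', ipK (x - B h) (B h') = 0) /\ y = T1 h.
have [||||A [Alin [AC hA]]] := @extend_op _ _ _ ipK ip hKs hH D C.
- exact: C0.
- move=> a x y x' y' [h [o ->]] [k [o' ->]]; exists (a *: h + k); split => [h'|].
    have -> : a *: x + y - B (a *: h + k) = a *: (x - B h) + (y - B k).
      by rewrite Blin scalerBr; zmod.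
    by rewrite (si_lin hKs) o o' mulr0 addr0.
  by rewrite Tlin.
- move=> x y [h [o ->]]; apply: le_trans (hC h) _; rewrite ler_wpM2l //.
  rewrite -(ler_pXn2r (n := 2)) ?nnegrE ?hnorm_ge0 //.
  have -> : hnorm ipK x = hnorm ipK (x - B h + B h) by rewrite subrK.
  by rewrite (hnormD_sq hKs) /rip o mulr0 addr0 lerDr sqr_ge0.
(* The domain of [D] is dense: project [x] on the closure [cl] of the range of [B], then approximate
   the projection by some [B h]. *)
- pose cl x := forall e : R, 0 < e -> exists h, hnorm ipK (x - B h) <= e.
  have hcl : closed_subspace ipK cl.
    split.
    + by move=> e e0; exists 0; rewrite (linmap0 Blin) subrr (hnorm0 hKs) ltW.
    + move=> a x y hx hy e e0.
      have a0 := normc_ge0 a.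
      pose k := normc a + 1; have k0 : 0 < k by rewrite ltr_wpDl.
      have ek : 0 < e / k by rewrite divr_gt0.
      have [h1 d1] := hx _ ek; have [h2 d2] := hy _ ek; exists (a *: h1 + h2).
      have -> : a *: x + y - B (a *: h1 + h2) = a *: (x - B h1) + (y - B h2).
        by rewrite Blin scalerBr; zmod.
      have -> : e = normc a * (e / k) + e / k by rewrite /k; field; rewrite gt_eqF.
      rewrite (le_trans (ler_hnormD hKs _ _)) // (hnormZ hKs) lerD //.
      by rewrite ler_wpM2l.
    + move=> x h e e0; have e2 : 0 < e / 2 by rewrite divr_gt0.
      have [y [hy d]] := h _ e2; have [k dk] := hy _ e2; exists k.
      have := ler_hnorm_split hKs y x (B k); lra.
  move=> x e e0; have [p [hp o]] := orthogonal_projection hK x hcl.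
  have [h dh] := hp e e0; exists (x - p + B h), (T1 h); split.
    exists h; split => // h'; have -> : x - p + B h - B h = x - p by zmod.
    by apply: o => e' e'0; exists h'; rewrite subrr (hnorm0 hKs) ltW.
  by have -> : x - (x - p + B h) = p - B h by zmod.
exists A; split; first by split => //; exists C.
by move=> h x o; apply: hA; exists h.
Qed.

Section ShiftGroup.
Variables (R : realType) (W K : lmodType R[i]) (ipK : K -> K -> R[i]).
Hypothesis hK : is_hilbert ipK.
Variable phi : R -> W -> K.
Hypothesis philin : forall t, linmap (phi t).
Hypothesis shift : forall r t s w v,
  ipK (phi (t + r) w) (phi (s + r) v) = ipK (phi t w) (phi s v).
Hypothesis phi_dense : forall x e, 0 < e -> exists l : seq (R * W),
  hnorm ipK (x - \sum_(p <- l) phi p.1 p.2) <= e.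
Hypothesis phi_cont : forall w e, 0 < e -> exists d : R, 0 < d /\
  forall t, `|t| < d -> hnorm ipK (phi t w - phi 0 w) < e.
Local Notation N := (hnorm ipK).
Let hs := hilbert_semi hK.

Let total (A : K -> Prop) : closed_subspace ipK A -> (forall t w, A (phi t w)) -> forall x, A x.
Proof.
move=> hA hphi x; apply: (cs_closed hA) => e /(phi_dense x)[l hl].
exists (\sum_(p <- l) phi p.1 p.2); split => //.
elim: l {hl} => [|p l IH]; first by rewrite big_nil; exact: cs0 hA.
by rewrite big_cons; apply: (cs_add hA).
Qed.

Let op_eq (F G : K -> K) : bounded_op ipK ipK F -> bounded_op ipK ipK G ->
  (forall t w, F (phi t w) = G (phi t w)) -> forall x, F x = G x.
Proof.
move=> bF bG FG x; apply/eqP; rewrite -subr_eq0; apply/eqP.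
apply: (total (closed_kernel hK (bounded_opB hK bF bG))) => t w.
by rewrite FG subrr.
Qed.

(** Moving all times by [r] preserves the inner products of generators, so the relation on finite
    sums is isometric and extends by density. *)
Let shift_op r : exists U : K -> K, [/\ linmap U, forall x, N (U x) <= N x &
  forall t w, U (phi t w) = phi (t + r) w].
Proof.
pose D x y := exists l : seq (R * W), x = \sum_(p <- l) phi p.1 p.2 /\
  y = \sum_(p <- l) phi (p.1 + r) p.2.
have ipsum (h : R -> R) (l l' : seq (R * W)) :
    ipK (\sum_(p <- l) phi (h p.1) p.2) (\sum_(q <- l') phi (h q.1) q.2) =
    \sum_(p <- l) \sum_(q <- l') ipK (phi (h p.1) p.2) (phi (h q.1) q.2).
  elim: l => [|p l IH]; first by rewrite !big_nil (ip0l hs).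
  rewrite !big_cons (ipDl hs) IH; congr (_ + _).
  elim: l' {IH} => [|q l' IH]; first by rewrite !big_nil (ip0r hs).
  by rewrite !big_cons (ipDr hs) IH.
have [||||U [Ulin [U1 hU]]] := @extend_op _ _ _ ipK ipK hs hK D 1.
- exact: ler01.
- move=> a x y x' y' [l [-> ->]] [l' [-> ->]].
  exists ([seq (p.1, a *: p.2) | p <- l] ++ l').
  rewrite !big_cat !big_map /= !scaler_sumr.
  by split; congr (_ + _); apply: eq_bigr => p _; rewrite (linmapZ _ _ (philin _)).
- move=> x y [l [-> ->]]; rewrite mul1r /hnorm (ipsum (fun t => t + r)) (ipsum id).
  rewrite le_eqVlt; apply/orP; left; apply/eqP; congr (Num.sqrt (complex.Re _)).
  by apply: eq_bigr => p _; apply: eq_bigr => q _; rewrite shift.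
- move=> x e e0; have [l hl] := phi_dense x e0.
  by exists (\sum_(p <- l) phi p.1 p.2), (\sum_(p <- l) phi (p.1 + r) p.2); split => //; exists l.
exists U; split => // [x|t w]; first by rewrite (le_trans (U1 x)) // mul1r.
by apply: hU; exists [:: (t, w)]; rewrite !big_seq1.
Qed.

Lemma shift_group : exists U : R -> K -> K,
  unitary_c0_group ipK U /\ forall r t w, U r (phi t w) = phi (t + r) w.
Proof.
have [U hU] := choice shift_op.
have Ulin r : linmap (U r) by case: (hU r).
have UN r x : N (U r x) <= N x by case: (hU r).
have Uphi r t w : U r (phi t w) = phi (t + r) w by case: (hU r).
have bU r : bounded_op ipK ipK (U r).
  by split; [exact: Ulin|exists 1 => x; rewrite mul1r].
have U0 x : U 0 x = x.
  have bid : bounded_op ipK ipK id by split => //; exists 1 => y; rewrite mul1r.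
  by apply: (op_eq (bU 0) bid) => t w; rewrite Uphi addr0.
have Uadd t s x : U (t + s) x = U t (U s x).
  apply: (op_eq (bU _) (bounded_op_comp (bU t) (bU s))) => r w.
  by rewrite !Uphi -addrA (addrC s).
(* [U r] and its inverse [U (- r)] are both contractions, hence isometric. *)
have Uiso r x : N (U r x) = N x.
  apply/eqP; rewrite eq_le UN /= -{1}(U0 x) -(addNr r) Uadd; exact: UN.
exists U; split => //; split => //; last first.
  by move=> t x y; exact: isometry_ip hs hs (Ulin t) (Uiso t) x y.
(* The vectors whose orbit is continuous at [0] form a closed subspace, because all [U t] are
   isometric; it then suffices to treat the generators. *)
pose cont x := forall e : R, 0 < e -> exists d : R, 0 < d /\
  forall t, `|t| < d -> N (U t x - x) < e.
apply: (total (A := cont)); last first.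
  move=> s w e e0; have [d [d0 hd]] := phi_cont w e0; exists d; split => // t td.
  have -> : U t (phi s w) - phi s w = U s (phi t w - phi 0 w).
    by rewrite (linmapB _ _ (Ulin s)) !Uphi add0r (addrC s).
  by rewrite Uiso hd.
split.
- by move=> e e0; exists 1; split => // t _; rewrite (linmap0 (Ulin t)) subrr (hnorm0 hs).
- move=> a x y hx hy e e0.
  have a0 := normc_ge0 a.
  pose k := normc a + 1; have k0 : 0 < k by rewrite ltr_wpDl.
  have ek : 0 < e / k by rewrite divr_gt0.
  have [d1 [d10 h1]] := hx _ ek; have [d2 [d20 h2]] := hy _ ek.
  exists (Num.min d1 d2); split; first by rewrite lt_min d10.
  move=> t; rewrite lt_min => /andP[/h1 {}h1 /h2 {}h2].
  have -> : U t (a *: x + y) - (a *: x + y) = a *: (U t x - x) + (U t y - y).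
    by rewrite Ulin scalerBr; zmod.
  have -> : e = normc a * (e / k) + e / k by rewrite /k; field; rewrite gt_eqF.
  rewrite (le_lt_trans (ler_hnormD hs _ _)) // (hnormZ hs) ler_ltD //.
  by rewrite ler_wpM2l // ltW.
- move=> x h e e0; have e4 : 0 < e / 4 by rewrite divr_gt0.
  have [y [hy dy]] := h _ e4; have [d [d0 hd]] := hy _ e4.
  exists d; split => // t /hd {}hd.
  have h1 := ler_hnorm_split hs (U t y) (U t x) x.
  have h2 := ler_hnorm_split hs y (U t y) x.
  have h3 := Uiso t (x - y); rewrite (linmapB _ _ (Ulin t)) in h3.
  rewrite (hnormBC hs y) in h2; lra.
Qed.

End ShiftGroup.

Section Dilation.
Variables (R : realType) (H : lmodType R[i]) (ip : H -> H -> R[i]).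
Hypothesis hH : is_hilbert ip.
Variable T : R -> H -> H.
Hypothesis hT : c0_semigroup ip T.
Variable f : H -> H -> R[i].
Hypothesis hf : semi_inner f.
Hypothesis f_contr : forall (t : R) x, 0 <= t -> hnorm f (T t x) <= hnorm f x.

(** Prescribed values of [<U(t) x, U(s) y> = <U(t - s) x, y>] for a dilation [U] that compresses to
    [T] at nonnegative times; hermitian symmetry dictates the second branch. *)
Definition dilation_kernel (t s : R) (x y : H) : R[i] :=
  if s <= t then f (T (t - s) x) y else f x (T (s - t) y).
Local Notation k := dilation_kernel.

Let Tlin (t : R) : 0 <= t -> linmap (T t).
Proof. by move=> /(sg_bounded hT) []. Qed.

Lemma dilation_kernel_lin t s a x x' y : k t s (a *: x + x') y = a * k t s x y + k t s x' y.
Proof.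
rewrite /dilation_kernel; case: ifP => st; last by rewrite (si_lin hf).
by rewrite Tlin ?subr_ge0 // (si_lin hf).
Qed.

Lemma dilation_kernel_herm t s x y : k s t y x = conjc (k t s x y).
Proof.
rewrite /dilation_kernel; case: (ltgtP s t) => [st|ts|->].
- exact: (si_conj hf).
- exact: (si_conj hf).
- by rewrite subrr !(sg_zero hT); exact: (si_conj hf).
Qed.

Lemma dilation_kernel_shift r t s x y : k (t + r) (s + r) x y = k t s x y.
Proof.
rewrite /dilation_kernel lerD2r.
have -> : t + r - (s + r) = t - s by ring.
by have -> : s + r - (t + r) = s - t by ring.
Qed.

Let gram (l : seq (R * H)) : R[i] := \sum_(p <- l) \sum_(q <- l) k p.1 q.1 p.2 q.2.

Let kDl t s x x' y : k t s (x + x') y = k t s x y + k t s x' y.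
Proof. by rewrite -[x]scale1r dilation_kernel_lin mul1r scale1r. Qed.

Let gram_cons p l : complex.Re (gram (p :: l)) = complex.Re (k p.1 p.1 p.2 p.2) +
  2 * complex.Re (\sum_(q <- l) k p.1 q.1 p.2 q.2) + complex.Re (gram l).
Proof.
have -> : gram (p :: l) = k p.1 p.1 p.2 p.2 + \sum_(q <- l) k p.1 q.1 p.2 q.2 +
    (\sum_(q <- l) k q.1 p.1 q.2 p.2 + gram l).
  rewrite /gram !big_cons; congr (_ + _).
  by under eq_bigr do rewrite big_cons; rewrite big_split.
have -> : \sum_(q <- l) k q.1 p.1 q.2 p.2 = conjc (\sum_(q <- l) k p.1 q.1 p.2 q.2).
  by rewrite rmorph_sum; apply: eq_bigr => q _; exact: dilation_kernel_herm.
by rewrite !raddfD /=; case: (\sum_(q <- l) _) => a b /=; ring.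
Qed.

Let kdiag t x : complex.Re (k t t x x) = hnorm f x ^+ 2.
Proof. by rewrite /dilation_kernel lexx subrr (sg_zero hT) (hnorm_sq hf). Qed.

Let later (p q : R * H) := q.1 <= p.1.

(* Moving the latest vector to the preceding time along [T] changes the Gram sum by
   [|x|^2 - |T(d) x|^2 >= 0]. *)
Let gram_sorted n l : size l = n -> sorted later l -> 0 <= complex.Re (gram l).
Proof.
elim: n l => [|n IH] [|[t1 x1] [|[t2 x2] l]] //=.
- by move=> _ _; rewrite /gram big_nil.
- by move=> _ _; rewrite gram_cons /= kdiag /gram !big_nil mulr0 !addr0 sqr_ge0.
move=> [sl] /andP[t21 pl]; rewrite /later /= in t21.
have d0 : 0 <= t1 - t2 by rewrite subr_ge0.
pose y := T (t1 - t2) x1.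
have pl' : path later (t2, x2 + y) l by case: (l) pl.
have := IH ((t2, x2 + y) :: l) sl pl'.
(* By the semigroup law, [x1] at time [t1] and [y] at time [t2] pair equally with every vector at a
   time up to [t2], so only the diagonal term changes. *)
have move_time s z : s <= t2 -> k t1 s x1 z = k t2 s y z.
  move=> st2; rewrite /dilation_kernel st2 (le_trans st2 t21) /y.
  rewrite -(sg_add hT) ?subr_ge0 //; congr (f (T _ _) _); ring.
have early q : q \in l -> q.1 <= t2.
  move=> ql; have tr : transitive later by move=> a b c h1 h2; exact: le_trans h2 h1.
  by have /allP/(_ q ql) := order_path_min tr pl.
have sumE : \sum_(q <- l) k t1 q.1 x1 q.2 = \sum_(q <- l) k t2 q.1 y q.2.
  by rewrite big_seq [RHS]big_seq; apply: eq_bigr => q /early; exact: move_time.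
have k12 : complex.Re (k t1 t2 x1 x2) = rip f x2 y.
  by rewrite /dilation_kernel t21 (ripC hf).
rewrite !gram_cons /= big_cons sumE !kdiag raddfD /= k12.
have -> : \sum_(q <- l) k t2 q.1 (x2 + y) q.2 =
    \sum_(q <- l) k t2 q.1 x2 q.2 + \sum_(q <- l) k t2 q.1 y q.2.
  by rewrite -big_split; apply: eq_bigr => q _; rewrite kDl.
rewrite raddfD /= (hnormD_sq hf).
have : hnorm f y ^+ 2 <= hnorm f x1 ^+ 2.
  by rewrite lerXn2r ?nnegrE ?hnorm_ge0 // f_contr.
lra.
Qed.

Lemma dilation_kernel_psd (l : seq (R * H)) :
  0 <= complex.Re (\sum_(p <- l) \sum_(q <- l) k p.1 q.1 p.2 q.2).
Proof.
have tot : total later by move=> p q; rewrite /later; exact: le_total.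
have := gram_sorted erefl (sort_sorted tot l).
rewrite /gram (perm_big l) ?perm_sort //=.
by under eq_bigr do rewrite (perm_big l) ?perm_sort //=.
Qed.

Hypothesis f_bound : exists C, forall x, hnorm f x <= C * hnorm ip x.
Variables (b C : R).
Hypotheses (b0 : 0 <= b) (C0 : 0 <= C).
Hypothesis f_lower : forall x, hnorm ip (T b x) <= C * hnorm f x.

Lemma unitary_dilation : exists (K : lmodType R[i]) (ipK : K -> K -> R[i]), is_hilbert ipK /\
  exists (B : H -> K) (A : K -> H) (U : R -> K -> K),
    bounded_op ip ipK B /\ bounded_op ipK ip A /\ unitary_c0_group ipK U /\
    forall t : R, b <= t -> forall x : H, T t x = A (U t (B x)).
Proof.
have [K [ipK [phi [hK philin phiE phid]]]] :=
  kernel_hilbert dilation_kernel_lin dilation_kernel_herm dilation_kernel_psd.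
have hKs := hilbert_semi hK.
have Nphi t x : hnorm ipK (phi t x) = hnorm f x.
  apply/eqP; rewrite -(@eqrXn2 _ 2) ?hnorm_ge0 // (hnorm_sq hKs) /rip phiE kdiag //.
have shift r t s w v : ipK (phi (t + r) w) (phi (s + r) v) = ipK (phi t w) (phi s v).
  by rewrite !phiE dilation_kernel_shift.
have [M hM] := f_bound.
have cont w (e : R) : 0 < e -> exists d : R, 0 < d /\
    forall t, `|t| < d -> hnorm ipK (phi t w - phi 0 w) < e.
  (* For [t >= 0] the squared distance is [- 2 * rip f (T t w - w) w], of first order in
     [T t w - w]; hence the tolerance [e ^+ 2 / c], with [c] absorbing the bound of [f] and
     [hnorm f w]. *)
  move=> e0; pose c := 2 * (`|M| * hnorm f w) + 1.
  have Mw : 0 <= `|M| * hnorm f w by rewrite mulr_ge0 ?hnorm_ge0.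
  have c0 : 0 < c by rewrite /c; lra.
  have [d [d0 hd]] := sg_cont hT w (divr_gt0 (exprn_gt0 2 e0) c0).
  have pos t : 0 <= t -> t < d -> hnorm ipK (phi t w - phi 0 w) < e.
    move=> t0 td; rewrite -(ltr_pXn2r (n := 2)) ?nnegrE ?hnorm_ge0 ?(ltW e0) //.
    have -> : hnorm ipK (phi t w - phi 0 w) ^+ 2 = - 2 * rip f (T t w - w) w.
      rewrite (hnormB_sq hKs) !Nphi /rip phiE /dilation_kernel t0 subr0.
      by rewrite -/(rip f (T t w) w) -/(rip f _ w) (ripBl hf) (hnorm_sq hf); ring.
    have h1 := rip_abs hf (T t w - w) w; rewrite ler_norml in h1.
    case/andP: h1 => h1 _.
    have h2 := hd t t0 td; have h3 := hM (T t w - w).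
    have h4 : M * hnorm ip (T t w - w) <= `|M| * (e ^+ 2 / c).
      apply: (@le_trans _ _ (`|M| * hnorm ip (T t w - w))).
        by rewrite ler_wpM2r ?hnorm_ge0 // ler_norm.
      by rewrite ler_wpM2l // ltW.
    have h5 : hnorm f (T t w - w) * hnorm f w <= `|M| * (e ^+ 2 / c) * hnorm f w.
      by rewrite ler_wpM2r ?hnorm_ge0 // (le_trans h3).
    have h6 : 2 * (`|M| * (e ^+ 2 / c) * hnorm f w) < e ^+ 2.
      have -> : 2 * (`|M| * (e ^+ 2 / c) * hnorm f w) = e ^+ 2 * (2 * (`|M| * hnorm f w) / c).
        by ring.
      by rewrite gtr_pMr ?exprn_gt0 // ltr_pdivrMr // mul1r /c ltrDl.
    lra.
  exists d; split => // t td; have [t0|t0] := leP 0 t; first by rewrite pos // -(ger0_norm t0).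
  (* Negative times reduce to positive ones by shifting both vectors by [- t]. *)
  have -> : hnorm ipK (phi t w - phi 0 w) = hnorm ipK (phi (- t) w - phi 0 w).
    rewrite (hnormBC hKs).
    suff E : hnorm ipK (phi 0 w - phi t w) ^+ 2 = hnorm ipK (phi (- t) w - phi 0 w) ^+ 2.
      by apply/eqP; rewrite -(@eqrXn2 _ 2) ?hnorm_ge0 // E.
    rewrite !(hnormB_sq hKs) !Nphi; congr (_ - 2 * _).
    by rewrite /rip -(shift (- t)) add0r addrN.
  by rewrite pos ?oppr_ge0 ?(ltW t0) // -(ltr0_norm t0).
have [U [hU Uphi]] := shift_group hK philin shift phid cont.
have Blow h : hnorm ip (T b h) <= C * hnorm ipK (phi 0 h) by rewrite Nphi.
have [A [bA hA]] := douglas_factorization hH hK (philin 0) (Tlin b0) C0 Blow.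
(* [phi s x - phi 0 (T s x)] is orthogonal to the range of [phi 0], so [A] sees only
   [phi 0 (T s x)]. *)
have Aphi s x : 0 <= s -> A (phi s x) = T b (T s x).
  move=> s0; apply: hA => h'; rewrite (ipBl hKs) !phiE /dilation_kernel s0 lexx subrr subr0.
  by rewrite (sg_zero hT) subrr.
exists K, ipK; split => //; exists (phi 0), (fun x => A (U (- b) x)), U.
split; first by split; [exact: philin|exists M => x; rewrite Nphi].
split; first exact: bounded_op_comp bA (ug_bounded hU _).
split=> // t bt x; rewrite !Uphi add0r Aphi ?subr_ge0 // -(sg_add hT) ?subr_ge0 //.
by rewrite addrC subrK.
Qed.

End Dilation.

(** * From factorizations to joint similarity, and the equivalences *)

Lemma jointly_similar_sub (R : realType) (H : lmodType R[i]) (ip : H -> H -> R[i])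
    (I J : Type) (F : I -> H -> H) (G : J -> H -> H) (h : J -> I) :
  (forall j, G j = F (h j)) -> jointly_similar_to_contractions ip F ->
  jointly_similar_to_contractions ip G.
Proof.
move=> GF [Q [g [bQ [bg [Qg [gQ c]]]]]]; exists Q, g; do 4!split => //.
by move=> j x; rewrite GF.
Qed.

(** The similarity [Q] is absorbed into [A] and [B], which makes [S] contractive; the times
    [t >= tau] are closed under addition, which supplies the composition law. *)
Lemma semigroup_compression_similar (R : realType) (H K : lmodType R[i])
    (ip : H -> H -> R[i]) (ipK : K -> K -> R[i]) (T : R -> H -> H) (S : R -> K -> K)
    (A : K -> H) (B : H -> K) (tau : R) :
  is_hilbert ip -> is_hilbert ipK -> c0_semigroup ip T -> c0_semigroup ipK S ->
  bounded_op ip ipK B -> bounded_op ipK ip A -> 0 < tau ->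
  semigroup_similar_to_contractions ipK S ->
  (forall t : R, tau <= t -> forall x : H, T t x = A (S t (B x))) ->
  jointly_similar_to_contractions ip (fun t : {t : R | tau <= t} => T (sval t)).
Proof.
move=> hH hK hT hS bB bA tau0 [Q [g [bQ [bg [Qg [gQ c]]]]]] TE.
have pos (t : {t : R | tau <= t}) : 0 <= sval t.
  by apply: le_trans (svalP t); exact: ltW.
apply: (compression_similar (A := fun x => A (g x)) (B := fun x => Q (B x))
  (S := fun (t : {t : R | tau <= t}) x => Q (S (sval t) (g x))) hH hK).
- exact: bounded_op_comp bA bg.
- exact: bounded_op_comp bQ bB.
- move=> t a x y; have [gl _] := bg; have [Ql _] := bQ.
  by have [Sl _] := sg_bounded hS (pos t); rewrite gl Sl Ql.
- by move=> t x; exact: (c (exist _ (sval t) (pos t)) x).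
- by move=> t x; rewrite !Qg TE //; exact: (svalP t).
- move=> t s; have ts : tau <= sval t + sval s.
    by apply: le_trans (svalP t) _; rewrite lerDl.
  exists (exist (fun t : R => tau <= t) _ ts) => /=.
  split=> x; last by rewrite (sg_add hT).
  by rewrite (sg_add hS) // Qg.
Qed.

Lemma unitary_group_semigroup (R : realType) (K : lmodType R[i]) (ipK : K -> K -> R[i])
    (U : R -> K -> K) : unitary_c0_group ipK U ->
  c0_semigroup ipK U /\ semigroup_similar_to_contractions ipK U.
Proof.
move=> hU; have bid : bounded_op ipK ipK id by split => //; exists 1 => x; rewrite mul1r.
split.
  split; [by move=> t _; exact: (ug_bounded hU)|exact: (ug_zero hU)|
    by move=> t s _ _; exact: (ug_add hU)|].
  move=> x e /(ug_cont hU x)[d [d0 hd]]; exists d; split => // t t0 td.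
  by apply: hd; rewrite ger0_norm.
exists id, id; do 4!split => //; move=> t x.
by rewrite /hnorm (ug_unitary hU).
Qed.

Theorem theorem1p1 (R : realType) (H : lmodType R[i]) (ip : H -> H -> R[i])
  (hH : is_hilbert ip) (T : R -> H -> H) (hT : c0_semigroup ip T) :
  let P1 := exists tau : R, 0 < tau /\ similar_to_contraction ip (T tau) in
  let P2 := forall tau : R, 0 < tau ->
      jointly_similar_to_contractions ip (fun t : {t : R | tau <= t} => T (sval t)) in
  let P3 := forall tau : R, 0 < tau ->
      exists (K : lmodType R[i]) (ipK : K -> K -> R[i]), is_hilbert ipK /\
      exists (B : H -> K) (A : K -> H) (U : R -> K -> K),
        bounded_op ip ipK B /\ bounded_op ipK ip A /\ unitary_c0_group ipK U /\
        forall t : R, tau <= t -> forall x : H, T t x = A (U t (B x)) in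
  let P4 := exists tau : R, 0 < tau /\
      exists (K : lmodType R[i]) (ipK : K -> K -> R[i]), is_hilbert ipK /\
      exists (B : H -> K) (A : K -> H) (S : R -> K -> K),
        bounded_op ip ipK B /\ bounded_op ipK ip A /\ c0_semigroup ipK S /\
        semigroup_similar_to_contractions ipK S /\
        forall t : R, tau <= t -> forall x : H, T t x = A (S t (B x)) in
  (P1 <-> P2) /\ (P2 <-> P3) /\ (P3 <-> P4).
Proof.
move=> P1 P2 P3 P4.
have joint_single (tau : R) :
    jointly_similar_to_contractions ip (fun t : {t : R | tau <= t} => T (sval t)) ->
    similar_to_contraction ip (T tau).
  by apply: (jointly_similar_sub (h := fun _ : unit => exist _ tau (lexx tau))).
have P13 : P1 -> P3.
  move=> [sigma [s0 [Q [g [bQ [bg [Qg [gQ c]]]]]]]] tau tau0.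
  (* [b <= tau] lets the factorization cover all [t >= tau]; [b < sigma] keeps [b] inside the
     averaging period. *)
  pose b := Num.min tau (sigma / 2).
  have b0 : 0 < b by rewrite lt_min tau0 divr_gt0.
  have bs : b < sigma.
    by rewrite gt_min; apply/orP; right; rewrite ltr_pdivrMr // ltr_pMr // ltr1n.
  have [f [hf fb fc [C [C0 hC]]]] :=
    contractive_form hH hT s0 bQ bg Qg (c tt) b0 bs.
  have [K [ipK [hK [B [A [U [bB [bA [hU TE]]]]]]]]] :=
    unitary_dilation hH hT hf fc fb (ltW b0) C0 hC.
  exists K, ipK; split => //; exists B, A, U; do 3!split => //.
  by move=> t tt0; apply: TE; rewrite (le_trans _ tt0) // ge_min lexx.
have P34 : P3 -> P4.
  move=> /(_ 1 ltr01) [K [ipK [hK [B [A [U [bB [bA [hU TE]]]]]]]]].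
  have [hS cS] := unitary_group_semigroup hU.
  by exists 1; split => //; exists K, ipK; split => //; exists B, A, U.
have P41 : P4 -> P1.
  move=> [tau [tau0 [K [ipK [hK [B [A [S [bB [bA [hS [cS TE]]]]]]]]]]]].
  exists tau; split => //; apply: joint_single.
  exact: semigroup_compression_similar hH hK hT hS bB bA tau0 cS TE.
have P32 : P3 -> P2.
  move=> h tau tau0; have [K [ipK [hK [B [A [U [bB [bA [hU TE]]]]]]]]] := h tau tau0.
  have [hS cS] := unitary_group_semigroup hU.
  exact: semigroup_compression_similar hH hK hT hS bB bA tau0 cS TE.
have P21 : P2 -> P1 by move=> h; exists 1; split => //; apply: joint_single; exact: h.
by split; [|split]; split; auto.
Qed.
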